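(* Let $\mathcal{X}$ be a non-empty class of complete metric spaces satisfying the six assumptions $(\mathrm{S}_{+})$, $(\mathrm{U})$, $(\mathrm{NPC}1)$, $(\mathrm{NPC}2)$, $(\mathrm{NPC}3)$ and $(\mathrm{TP})$ (defined in the context), and assume moreover that $\mathcal{X}$ either consists of Banach spaces or consists of $\mathrm{CAT}(0)$ spaces. Let $G$ be a finitely generated group, let $M,L\leqslant G$ be subgroups and let $\Pi\leqslant \mathrm{Aut}(G)$ be a subgroup. Assume that: (i) the union $M\cup L$ generates $G$; (ii) the group $\Pi$ is finite; (GAME$^+$) the player has a winning strategy for the $(\mathrm{Game}^{+})$ for $(M,L,\Pi)$ (defined in the context). If both $G\geqslant M$ and $G\geqslant L$ have relative property $(\mathrm{F}_{\mathcal{X}})$, then $G$ has property $(\mathrm{F}_{\mathcal{X}})$.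
   Context: Conventions: all metric spaces are non-empty and complete; all group actions on metric spaces are by isometries. For an action $\alpha\colon \Lambda\curvearrowright X$ and $M\leqslant \Lambda$, $X^{\alpha(M)}=\{x\in X:\alpha(h)\cdot x=x \text{ for all } h\in M\}$. For a countable group $\Lambda$ and $M\leqslant\Lambda$, the pair $\Lambda\geqslant M$ has relative property $(\mathrm{F}_{\mathcal{X}})$ if for every $X\in\mathcal{X}$ and every action $\alpha\colon\Lambda\curvearrowright X$ one has $X^{\alpha(M)}\neq\emptyset$. A finitely generated group $G$ has property $(\mathrm{F}_{\mathcal{X}})$ if $G\geqslant G$ has relative property $(\mathrm{F}_{\mathcal{X}})$. Geodesic segments are minimal (isometric embeddings of real segments). In a uniquely geodesic space $(X,d)$ (every pair of points is joined by a unique geodesic segment), $[x,y]$ is the oriented geodesic segment from $x$ to $y$, and for $0\le t\le 1$, $m_t[x,y]$ is the point of $[x,y]$ dividing it internally at ratio $t:(1-t)$. Write $[x,y]\,||\,[x',y']$ if $d(x,x')=d(y,y')=d(m_{1/2}[x,y],m_{1/2}[x',y'])$. Assumptions on $\mathcal{X}$ (a condition on spaces is required for every $X\in\mathcal{X}$): - $(\mathrm{S}_{+})$: for $(X,d)\in\mathcal{X}$ and $r\geq 1$, $(X,rd)\in\mathcal{X}$. - $(\mathrm{U})$: there is a non-principal ultrafilter $\mathcal{U}$ on $\mathbb{N}$ such that for all $X_n\in\mathcal{X}$ and $w_n\in X_n$ ($n\in\mathbb{N}$), the pointed metric ultraproduct $\lim_{\mathcal{U}}(X_n,w_n)$ belongs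 to $\mathcal{X}$ (after forgetting the base point). Here $\lim_{\mathcal{U}}(X_n,d_n,w_n)$ is the quotient of $\{(x_n)_n\in\prod X_n:\sup_n d_n(x_n,w_n)<\infty\}$ with semi-metric $\lim_{\mathcal{U}}d_n(x_n,y_n)$ by the relation of being at distance $0$, with base point $[(w_n)_n]$. - $(\mathrm{NPC}1)$: $X$ is uniquely geodesic, and for all geodesic segments $[x,y],[x',y']$ with $d(x,x')=d(y,y')$ and all $0\le t\le 1$, $d(m_t[x,y],m_t[x',y'])\le d(x,x')$. - $(\mathrm{NPC}2)$: if $[x,y]\,||\,[x',y']$, then $[x,x']\,||\,[y,y']$. - $(\mathrm{NPC}3)$: if $[x,y]\,||\,[y,z]$, then the concatenation $[x,y]\cup[y,z]$ is a geodesic. - $(\mathrm{TP})$: if $[x,y]\,||\,[x',y']$ and $[x',y']\,||\,[x'',y'']$, then $[x,y]\,||\,[x'',y'']$. The $(\mathrm{Game}^{+})$ for $(M,L,\Pi)$: a one-player game with $M,L,\Pi$ fixed and two subgroups $H_1,H_2\leqslant G$ varying stage by stage. Initially $H_1=M$, $H_2=L$. At each stage the player may perform one of the following moves. - Type $(\mathrm{I}^{+})$ move: pick a subset $P\subseteq G$ such that $hH_1h^{-1}\geqslant M$ and $hH_2h^{-1}\geqslant L$ for all $h\in P$. Then replace $H_1$ by $\langle H_1,P\rangle$ and $H_2$ by $\langle H_2,P\rangle$. - Type $(\mathrm{II}_{\sigma})$ move, for $\sigma\in\mathrm{Sym}(2)$: pick a subset $\Lambda\subseteq\mathrm{Inn}(G)\cdot\Pi$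 such that $H_{\sigma^{-1}(1)}\geqslant\phi(M)$ and $H_{\sigma^{-1}(2)}\geqslant\phi(L)$ for all $\phi\in\Lambda$. Then simultaneously replace $H_1$ by $\langle H_1,\bigcup_{\phi\in\Lambda}\phi(H_{\sigma(1)})\rangle$ and $H_2$ by $\langle H_2,\bigcup_{\phi\in\Lambda}\phi(H_{\sigma(2)})\rangle$. The player wins if after finitely many moves $H_1=G$ or $H_2=G$. *)

(* Defs.v *)
From HB Require Import structures.
From mathcomp Require Import all_boot all_order all_algebra all_fingroup.
From mathcomp Require Import generic_quotient.
From mathcomp Require Import all_classical all_reals all_analysis.

Set Implicit Arguments.
Unset Strict Implicit.
Unset Printing Implicit Defensive.

Import Order.TTheory GRing.Theory Num.Theory.
Import numFieldNormedType.Exports.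

Local Open Scope classical_set_scope.
Local Open Scope ring_scope.
Local Open Scope quotient_scope.

Section Geodesics.
Context {R : realType} {X : metricType R}.
Implicit Types (x y z : X) (l : R) (c : R -> X).

(* The values of [c] outside [0, l] are irrelevant; necessarily
   [l = mdist x y]. *)
Definition geodesic l x y c : Prop :=
  [/\ 0 <= l, c 0 = x, c l = y &
      forall s t, 0 <= s <= l -> 0 <= t <= l -> mdist (c s) (c t) = `|s - t|].

Definition concat_path l c1 c2 : R -> X :=
  fun t => if t <= l then c1 t else c2 (t - l).

(* m_t[x,y].  The set below is a singleton as soon as X is uniquely geodesic
   and 0 <= t <= 1; the default value x is then never used. *)
Definition ratio_pt (t : R) x y : X :=
  xget x [set z | exists2 c, geodesic (mdist x y) x y c & z = c (t * mdist x y)].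

(* [x,y] || [x',y'] *)
Definition parallel_seg x y x' y' : Prop :=
  mdist x x' = mdist y y' /\
  mdist y y' = mdist (ratio_pt 2^-1 x y) (ratio_pt 2^-1 x' y').

End Geodesics.

Section SpaceConditions.
Context {R : realType}.
Implicit Type X : metricType R.

Definition nonempty_space X : Prop := [set: X] !=set0.

Definition complete_space X : Prop :=
  forall F : set_system X, ProperFilter F -> cauchy F -> exists x : X, F --> x.

Definition geodesic_space X : Prop :=
  forall x y : X, exists c, geodesic (mdist x y) x y c.

Definition uniquely_geodesic X : Prop :=
  geodesic_space X /\
  forall (x y : X) c c',
    geodesic (mdist x y) x y c -> geodesic (mdist x y) x y c' ->
    forall t, 0 <= t <= mdist x y -> c t = c' t.

Definition NPC1 X : Prop :=
  uniquely_geodesic X /\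
  forall (x y x' y' : X) (t : R), mdist x x' = mdist y y' -> 0 <= t <= 1 ->
    mdist (ratio_pt t x y) (ratio_pt t x' y') <= mdist x x'.

Definition NPC2 X : Prop :=
  forall x y x' y' : X, parallel_seg x y x' y' -> parallel_seg x x' y y'.

Definition NPC3 X : Prop :=
  forall x y z : X, parallel_seg x y y z ->
  forall c1 c2,
    geodesic (mdist x y) x y c1 -> geodesic (mdist y z) y z c2 ->
    geodesic (mdist x y + mdist y z) x z (concat_path (mdist x y) c1 c2).

Definition TP X : Prop :=
  forall x y x' y' x'' y'' : X,
    parallel_seg x y x' y' -> parallel_seg x' y' x'' y'' ->
    parallel_seg x y x'' y''.

(* X is, as a metric space, a real Banach space. *)
Definition is_banach X : Prop :=
  exists (E : completeNormedModType R) (f : X -> E),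
    bijective f /\ forall x y, mdist x y = `|f x - f y|.

(* The norm of the product [R * R] is the sup norm, whence this definition. *)
Definition plane_dist (p q : R^o * R^o) : R :=
  Num.sqrt ((p.1 - q.1) ^+ 2 + (p.2 - q.2) ^+ 2).

(* p' is the comparison point, on the segment [x',y'] of the plane, of the
   point p of the side c from x to y. *)
Definition comparison_pt X (x y : X) (c : R -> X) (x' y' : R^o * R^o)
    (p : X) (p' : R^o * R^o) : Prop :=
  exists t : R, [/\ 0 <= t <= 1, p = c (t * mdist x y) &
                    p' = (1 - t) *: x' + t *: y'].

Definition is_CAT0 X : Prop :=
  geodesic_space X /\
  forall (x y z : X) (cxy cyz czx : R -> X) (x' y' z' : R^o * R^o),
    geodesic (mdist x y) x y cxy ->
    geodesic (mdist y z) y z cyz ->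
    geodesic (mdist z x) z x czx ->
    plane_dist x' y' = mdist x y ->
    plane_dist y' z' = mdist y z ->
    plane_dist z' x' = mdist z x ->
    let cmp p p' := [\/ comparison_pt x y cxy x' y' p p',
                        comparison_pt y z cyz y' z' p p' |
                        comparison_pt z x czx z' x' p p'] in
    forall (p q : X) (p' q' : R^o * R^o), cmp p p' -> cmp q q' ->
      mdist p q <= plane_dist p' q'.

End SpaceConditions.

(* The space (X, r d). *)
Section Rescaling.
Context {R : realType} (X : metricType R) (r : R) (r_ge1 : 1 <= r).

Definition rescaled of 1 <= r : Type := X.
Local Notation rX := (rescaled r_ge1).

HB.instance Definition _ := Choice.on rX.

Let dist (x y : rX) : R := r * mdist (x : X) (y : X).

Let distxx x : dist x x = 0.
Proof. by rewrite /dist mdistxx mulr0. Qed.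

Let dist_positivity x y : dist x y = 0 -> x = y.
Proof.
have r_gt0 : 0 < r by exact: lt_le_trans ltr01 r_ge1.
by move/eqP; rewrite mulf_eq0 gt_eqF //= => /eqP; exact: mdist_positivity.
Qed.

Let dist_sym x y : dist x y = dist y x.
Proof. by rewrite /dist metric_sym. Qed.

Let dist_triangle y x z : dist x z <= dist x y + dist y z.
Proof.
rewrite /dist -mulrDr ler_wpM2l ?metric_triangle//.
exact: le_trans ler01 r_ge1.
Qed.

HB.instance Definition _ :=
  isMetric.Build R rX distxx dist_positivity dist_sym dist_triangle.

Lemma rescaledE (x y : rX) : mdist x y = r * mdist (x : X) (y : X).
Proof. by []. Qed.

End Rescaling.

Lemma bounded_ultra_cvg (R : realType) (U : set_system nat)
    (UF : UltraFilter U) (f : nat -> R) (C : R) :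
  (forall n, 0 <= f n <= C) -> cvg (f @ U).
Proof.
move=> fC.
have [l [_ cl]] : `[0, C]%classic `&` cluster (f @ U) !=set0.
  apply: segment_compact; rewrite /fmap /=.
  by apply: filterE => n; have := fC n; rewrite /= in_itv.
apply/cvg_ex; exists l => B Bl.
have [//|UB] := in_ultra_setVsetC (f @^-1` B) UF.
by have [y [nBy By]] := cl (~` B) B UB Bl; case: nBy.
Qed.

(* lim_U (X_n, w_n), without its base point. *)
Section Ultraproduct.
Context {R : realType} (U : set_system nat) (UF : UltraFilter U).
Context (X : nat -> metricType R) (w : forall n, X n).

Definition bounded_seq : Type :=
  {x : forall n, X n | exists C : R, forall n, mdist (x n) (w n) <= C}.

HB.instance Definition _ := gen_eqMixin bounded_seq.
HB.instance Definition _ := gen_choiceMixin bounded_seq.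

Definition ultra_dist (x y : bounded_seq) : R :=
  lim ((fun n => mdist (sval x n) (sval y n)) @ U).

Lemma ultra_dist_cvg x y :
  (fun n => mdist (sval x n) (sval y n)) @ U --> ultra_dist x y.
Proof.
case: x y => [x [C xC]] [y [D yD]]; rewrite /ultra_dist /=.
apply: (@bounded_ultra_cvg _ _ UF _ (C + D)) => n; rewrite mdist_ge0 /=.
apply: le_trans (metric_triangle _ (w n) _) _.
by rewrite lerD // metric_sym.
Qed.

Lemma ultra_distxx x : ultra_dist x x = 0.
Proof.
have := @ultra_dist_cvg x x.
under eq_fun do rewrite mdistxx.
move=> h; apply: (cvg_unique _ h) => //; exact: cvg_cst.
Qed.

Lemma ultra_dist_sym x y : ultra_dist x y = ultra_dist y x.
Proof. by rewrite /ultra_dist; under eq_fun do rewrite metric_sym. Qed.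

Lemma ultra_dist_ge0 x y : 0 <= ultra_dist x y.
Proof.
apply: limr_ge; first exact: ultra_dist_cvg.
by apply: filterE => n; exact: mdist_ge0.
Qed.

Lemma ultra_dist_triangle y x z :
  ultra_dist x z <= ultra_dist x y + ultra_dist y z.
Proof.
apply: (ler_cvg_to (@ultra_dist_cvg x z)
  (cvgD (@ultra_dist_cvg x y) (@ultra_dist_cvg y z))).
by apply: filterE => n; exact: metric_triangle.
Qed.

Definition ultra_rel (x y : bounded_seq) : bool := ultra_dist x y == 0.

Lemma ultra_rel_equiv : equiv_class_of ultra_rel.
Proof.
split=> [x|x y|y x z]; rewrite /ultra_rel ?ultra_distxx //.
  by rewrite ultra_dist_sym.
move=> /eqP xy /eqP yz; rewrite eq_le ultra_dist_ge0 andbT.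
by rewrite (le_trans (@ultra_dist_triangle y _ _))// xy yz addr0.
Qed.

Canonical ultra_equiv := EquivRelPack ultra_rel_equiv.

Definition ultraproduct : Type := {eq_quot ultra_equiv}.

HB.instance Definition _ := Choice.on ultraproduct.

Definition ultraproduct_pt (x : bounded_seq) : ultraproduct :=
  \pi_{eq_quot ultra_equiv} x.

Let rep (a : ultraproduct) : bounded_seq :=
  repr (a : {eq_quot ultra_equiv}).

Let dist (a b : ultraproduct) : R := ultra_dist (rep a) (rep b).

Let dist_pt x y : dist (ultraproduct_pt x) (ultraproduct_pt y) = ultra_dist x y.
Proof.
have rep0 z : ultra_dist (rep (ultraproduct_pt z)) z = 0.
  apply/eqP; rewrite -[_ == 0]/(ultra_equiv _ _).
  by apply/eqmodP; rewrite reprK.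
have h u v u' v' : ultra_dist u u' = 0 -> ultra_dist v v' = 0 ->
    ultra_dist u v <= ultra_dist u' v'.
  move=> uu vv; rewrite (le_trans (@ultra_dist_triangle u' _ _))// uu add0r.
  rewrite (le_trans (@ultra_dist_triangle v' _ _))//.
  by rewrite [ultra_dist v' v]ultra_dist_sym vv addr0.
by apply/eqP; rewrite eq_le !h // ultra_dist_sym rep0.
Qed.

Let distxx a : dist a a = 0.
Proof. exact: ultra_distxx. Qed.

Let dist_positivity a b : dist a b = 0 -> a = b.
Proof.
move=> /eqP ab; rewrite -[a](@reprK _ {eq_quot ultra_equiv}).
by rewrite -[b](@reprK _ {eq_quot ultra_equiv}); apply/eqmodP.
Qed.

Let dist_sym a b : dist a b = dist b a.
Proof. exact: ultra_dist_sym. Qed.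

Let dist_triangle b a c : dist a c <= dist a b + dist b c.
Proof. exact: ultra_dist_triangle. Qed.

HB.instance Definition _ :=
  isMetric.Build R ultraproduct distxx dist_positivity dist_sym dist_triangle.

Lemma ultraproduct_mdist (x y : bounded_seq) :
  mdist (ultraproduct_pt x) (ultraproduct_pt y) =
  lim ((fun n => mdist (sval x n) (sval y n)) @ U).
Proof. exact: dist_pt. Qed.

End Ultraproduct.

Section ClassConditions.
Context {R : realType} (XX : metricType R -> Prop).

Definition S_plus : Prop :=
  forall (X : metricType R) (r : R) (r_ge1 : 1 <= r),
    XX X -> XX (rescaled X r_ge1).

Definition U_closed : Prop :=
  exists (U : set_system nat) (UF : UltraFilter U),
    (forall n, ~ U [set n]) /\
    forall (X : nat -> metricType R) (w : forall n, X n),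
      (forall n, XX (X n)) -> XX (ultraproduct UF w).

End ClassConditions.

Section Groups.
Context {G : groupType}.
Local Open Scope group_scope.
Implicit Types (H M : set G) (phi : G -> G).

Definition is_subgroup H : Prop := group_closed (mem H).

Definition subgroup_closure (A : set G) : set G := smallest is_subgroup A.

Definition conj_set (h : G) H : set G := [set h * x * h^-1 | x in H].

Definition is_automorphism phi : Prop :=
  bijective phi /\ {morph phi : x y / x * y}.

(* Elements of Aut(G) are represented by their underlying functions. *)
Definition is_aut_subgroup (Pi : set (G -> G)) : Prop :=
  [/\ Pi `<=` is_automorphism, Pi id,
      (forall phi psi, Pi phi -> Pi psi -> Pi (phi \o psi)) &
      (forall phi psi, Pi phi -> cancel phi psi -> cancel psi phi -> Pi psi)].

(* Inn(G) . Pi *)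
Definition inn_mul (Pi : set (G -> G)) : set (G -> G) :=
  [set phi | exists g : G, exists2 psi, Pi psi &
     phi = (fun x => g * psi x * g^-1)].

Definition isometric_action {R : realType} (X : metricType R)
    (alpha : G -> X -> X) : Prop :=
  [/\ forall x, alpha 1 x = x,
      forall g h x, alpha (g * h) x = alpha g (alpha h x) &
      forall g x y, mdist (alpha g x) (alpha g y) = mdist x y].

Definition fixed_points {R : realType} (X : metricType R)
    (alpha : G -> X -> X) M : set X :=
  [set x | forall h, M h -> alpha h x = x].

Definition relative_F {R : realType} (XX : metricType R -> Prop) M : Prop :=
  forall X : metricType R, XX X ->
  forall alpha : G -> X -> X, isometric_action alpha ->
    fixed_points alpha M !=set0.

(* A state is the pair (H_1, H_2), indexed by 'I_2 so that Sym(2) = 'S_2 acts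
   on the indices: H_1 is [H ord0] and H_2 is [H ord_max]. *)
Definition initial_state M L : 'I_2 -> set G :=
  fun i => if i == ord0 then M else L.

Definition move_I (M L : set G) (H H' : 'I_2 -> set G) : Prop :=
  exists P : set G,
    (forall h, P h -> forall i, initial_state M L i `<=` conj_set h (H i)) /\
    (forall i, H' i = subgroup_closure (H i `|` P)).

Definition move_II (s : 'S_2) (M L : set G) (Pi : set (G -> G))
    (H H' : 'I_2 -> set G) : Prop :=
  exists Lam : set (G -> G),
    [/\ Lam `<=` inn_mul Pi,
        (forall phi, Lam phi ->
           forall i, phi @` initial_state M L i `<=` H (s^-1 i)) &
        (forall i, H' i =
           subgroup_closure (H i `|` \bigcup_(phi in Lam) (phi @` H (s i))))].

Inductive game_reachable (M L : set G) (Pi : set (G -> G)) :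
    ('I_2 -> set G) -> Prop :=
| game_start : game_reachable M L Pi (initial_state M L)
| game_I (H H' : 'I_2 -> set G) : game_reachable M L Pi H -> move_I M L H H' ->
    game_reachable M L Pi H'
| game_II s (H H' : 'I_2 -> set G) : game_reachable M L Pi H -> move_II s M L Pi H H' ->
    game_reachable M L Pi H'.

Definition game_winnable (M L : set G) (Pi : set (G -> G)) : Prop :=
  exists2 H, game_reachable M L Pi H & exists i, H i = [set: G].

End Groups.

Definition finitely_generated (G : groupType) : Prop :=
  exists2 A : set G, finite_set A & subgroup_closure A = [set: G].

Definition property_F {R : realType} (XX : metricType R -> Prop) (G : groupType)
  : Prop := relative_F XX [set: G].

(* Main.v *)
Require Import Defs.
From HB Require Import structures.
From mathcomp Require Import all_boot all_order all_algebra all_fingroup.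
From mathcomp Require Import generic_quotient.
From mathcomp Require Import all_classical all_reals all_analysis.
From mathcomp Require Import ring lra.

(** If G has no fixed point on some X in the class, the Gromov-Schoen argument
(rescaling around points of almost minimal displacement, then an ultraproduct)
yields an action displacing every point by at least 1 under some element of a
finite Pi-invariant generating set S.  Among all such actions, the infimum of
d(x, y) over x fixed by M and y fixed by L is attained, again by an
ultraproduct.  One shows by induction on the game that every minimising pair
(x, y) is fixed by (H_1, H_2), so that winning the game contradicts the choice
of S.  For a move of type II, precompose the action with phi: the class of
actions is stable since S is Pi-invariant.  For a move of type I, (h x, h y) is
again minimising, so [x, h x] is parallel to its translates by M (trivially),
by L (through [y, h y]), hence by G.  A non-trivial such h x gives a morphism
psi : G -> R bounded on M and on L, hence zero, with psi h <> 0: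
- in CAT(0) spaces psi is the limit of 2 <x gx, x h^n x> / n for the
  Berg-Nikolaev quasi-inner product;
- in Banach spaces v = h x - x is fixed by the linear part of the action, and
  psi g = f (g x - x) for an invariant functional f with f v <> 0.  Since
  ultrapowers are uniquely geodesic, the space is uniformly convex.  Averaging
  a norming functional along the random walk on S gives a harmonic f; if f were
  not invariant, the vectors testing the increments of f along the walk would
  form a martingale with bounded increments and linearly growing norm, which
  uniform convexity forbids. *)

Set Implicit Arguments.
Unset Strict Implicit.
Unset Printing Implicit Defensive.

Import Order.TTheory GRing.Theory Num.Theory.
Import numFieldNormedType.Exports.

Local Open Scope classical_set_scope.
Local Open Scope ring_scope.
Local Open Scope quotient_scope.

(** * Averages and random walks in uniformly convex spaces *)

Section UniformConvexity.
Context {R : realType} {E : normedModType R}.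

(** Parallelogram form of uniform convexity: for [d = 0] the bound holds in every normed space, and
    the gain [d] is asked only of pairs separated by a fixed proportion of their size. *)
Definition uniformly_convex_with (d : R) : Prop :=
  forall a b : E, (`|a| + `|b|) / 10 <= `|a - b| ->
    `|a + b| ^+ 2 <= 2 * (1 - d) * (`|a| ^+ 2 + `|b| ^+ 2).

(** As [Y] has mean zero, the vectors [Y w] are on average at distance at least [|x|] from [x].
    Hence the pairs separated enough to gain from convexity carry at least an eighth of the total
    weight. *)
Lemma uniformly_convex_centered (d : R) (W : finType) (x : E) (Y : W -> E) :
  0 < d -> uniformly_convex_with d -> \sum_w Y w = 0 ->
  \sum_w `|x + Y w| ^+ 2 <=
    2 * (1 - d / 8) * (#|W|%:R * `|x| ^+ 2 + \sum_w `|Y w| ^+ 2).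
Proof.
move=> d0 uc Y0.
pose good w : R := ((`|x| + `|Y w|) / 10 <= `|x - Y w|)%R%:R.
pose s w : R := `|x| ^+ 2 + `|Y w| ^+ 2.
have sE : #|W|%:R * `|x| ^+ 2 + \sum_w `|Y w| ^+ 2 = \sum_w s w.
  by rewrite big_split /= sumr_const mulr_natl.
have i1 w : `|x + Y w| ^+ 2 <= 2 * s w - 2 * d * (good w * s w).
  have tri := ler_normD x (Y w); have z0 := normr_ge0 (x + Y w).
  have sq : `|x + Y w| ^+ 2 <= (`|x| + `|Y w|) ^+ 2.
    by rewrite lerXn2r// nnegrE addr_ge0.
  have sq' := sqr_ge0 (`|x| - `|Y w|).
  rewrite /good /s.
  case: (boolP ((`|x| + `|Y w|) / 10 <= `|x - Y w|)%R) => [/uc uc' | _].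
    by rewrite mul1r; lra.
  by rewrite mul0r; lra.
have i2 w : `|x| * `|x - Y w| <= 3 / 20 * s w + 3 / 2 * (good w * s w).
  have tri := ler_normB x (Y w); have x0 := normr_ge0 x.
  have sq' := sqr_ge0 (`|x| - `|Y w|); have sqy := sqr_ge0 `|Y w|.
  have sqx := sqr_ge0 `|x|.
  rewrite /good /s.
  case: (leP ((`|x| + `|Y w|) / 10) `|x - Y w|) => [_|/ltW h].
    by have := ler_wpM2l x0 tri; rewrite mul1r; lra.
  by have := ler_wpM2l x0 h; rewrite mul0r; lra.
have i3 w : s w <= 5 / 2 * `|x| ^+ 2 + good w * s w.
  have tri := lerB_dist (Y w) x; have dc := distrC x (Y w).
  have sqx := sqr_ge0 `|x|.
  rewrite /good /s; case: (leP ((`|x| + `|Y w|) / 10) `|x - Y w|) => h.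
    by rewrite mul1r; lra.
  have x0 := normr_ge0 x; have yx : `|Y w| <= 11 / 9 * `|x| by lra.
  have : `|Y w| ^+ 2 <= (11 / 9 * `|x|) ^+ 2.
    by rewrite lerXn2r ?nnegrE ?normr_ge0//; lra.
  by rewrite mul0r exprMn; lra.
have i4 : #|W|%:R * `|x| ^+ 2 <= \sum_w `|x| * `|x - Y w|.
  rewrite -mulr_sumr expr2 mulrCA ler_wpM2l//.
  have -> : #|W|%:R * `|x| = `|\sum_w (x - Y w)|.
    by rewrite sumrB Y0 subr0 sumr_const normrMn mulr_natl.
  exact: ler_norm_sum.
rewrite sE; set T := \sum_w s w; pose Gd := \sum_w good w * s w.
have s1 : \sum_w `|x + Y w| ^+ 2 <= 2 * T - 2 * d * Gd.
  by rewrite /T /Gd !mulr_sumr -sumrB; apply: ler_sum => w _; exact: i1.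
have s2 : \sum_w `|x| * `|x - Y w| <= 3 / 20 * T + 3 / 2 * Gd.
  by rewrite /T /Gd !mulr_sumr -big_split; apply: ler_sum => w _; exact: i2.
have s3 : T <= 5 / 2 * (#|W|%:R * `|x| ^+ 2) + Gd.
  rewrite mulrCA [X in X + _]mulr_natl -sumr_const -big_split.
  by apply: ler_sum => w _; exact: i3.
have Gd0 : 0 <= Gd.
  by apply: sumr_ge0 => w _; rewrite mulr_ge0 ?addr_ge0 ?sqr_ge0.
(* Combining [i4], [s2] and [s3] gives the constant 7.6, rounded up to 8; this is the origin of
   [d / 8]. *)
have TGd : T <= 8 * Gd by lra.
by have := ler_wpM2l (ltW d0) TGd; lra.
Qed.

End UniformConvexity.

(** * Martingales along random walks and harmonic functionals *)

Section HarmonicFunctional.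
Context {R : realType} {E : normedModType R} {G : groupType}.
Variables (pi : G -> E -> E) (d : R).
Hypotheses (d0 : 0 < d) (d1 : 0 <= 1 - d / 8) (uc : @uniformly_convex_with R E d).
Hypotheses (piD : forall g, {morph pi g : x y / x + y})
  (piM : forall g h x, pi (g * h)%g x = pi g (pi h x))
  (pi1 : forall x, pi 1%g x = x)
  (pi_norm : forall g x, `|pi g x| = `|x|).
Variables (f : E -> R).
Hypotheses (fD : {morph f : x y / x + y}) (f_le : forall x, `|f x| <= `|x|).

Let pi0 g : pi g 0 = 0.
Proof. by apply: (@addrI _ (pi g 0)); rewrite -piD !addr0. Qed.

Let piV g : cancel (pi g) (pi g^-1%g).
Proof. by move=> x; rewrite -piM mulVg pi1. Qed.

Let piVK g : cancel (pi g^-1%g) (pi g).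
Proof. by move=> x; rewrite -piM mulgV pi1. Qed.

Let piN g x : pi g (- x) = - pi g x.
Proof. by apply: (@addrI _ (pi g x)); rewrite -piD !subrr pi0. Qed.

Let piMn g x n : pi g (x *+ n) = pi g x *+ n.
Proof. by elim: n => [|n IH]; rewrite ?mulr0n// !mulrS piD IH. Qed.

Let pi_sum g (I : finType) (F : I -> E) :
  pi g (\sum_i F i) = \sum_i pi g (F i).
Proof. exact: (big_morph _ (piD g) (pi0 g)). Qed.

Let f0 : f 0 = 0.
Proof. by apply: (@addrI _ (f 0)); rewrite -fD !addr0. Qed.

Let fN x : f (- x) = - f x.
Proof. by apply: (@addrI _ (f x)); rewrite -fD !subrr f0. Qed.

Let fMn x n : f (x *+ n) = f x *+ n.
Proof. by elim: n => [|n IH]; rewrite ?mulr0n// !mulrS fD IH. Qed.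

Let c_ge0 : 0 <= 4 * (1 - d / 8) :> R.
Proof. by rewrite mulr_ge0. Qed.

(* [gam w] is the endpoint of a random walk path [w] of length [2 ^ j] and
   [pi (gam w)^-1 (Z w)] the endpoint of a martingale with bounded increments;
   [e] is the mean of [f (Z w)] contributed by one step. *)
Definition martingale_block (e A : R) (j : nat) : Prop :=
  exists (W : finType) (gam : W -> G) (Z : W -> E),
  [/\ (0 < #|W|)%N,
      \sum_w pi (gam w)^-1%g (Z w) = 0,
      \sum_w `|Z w| ^+ 2 <= #|W|%:R * ((4 * (1 - d / 8)) ^+ j * A),
      forall z, \sum_w f (pi (gam w) z) = #|W|%:R * f z &
      \sum_w f (Z w) = #|W|%:R * (2 ^+ j * e)].

(** Two independent copies of the path are concatenated. The mean of [f] doubles because [f] is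
    harmonic, while the mean square grows by [4 * (1 - d / 8)] instead of 4 because the second half
    is centered given the first. *)
Lemma martingale_block_double e A j :
  martingale_block e A j -> martingale_block e A j.+1.
Proof.
move=> [W [gam [Z [W0 Z0 ZA gf fZ]]]].
exists (W * W)%type, (fun p => gam p.2 * gam p.1)%g,
  (fun p => pi (gam p.2) (Z p.1) + Z p.2).
have n0 : 0 < #|W|%:R :> R by rewrite ltr0n.
rewrite card_prod natrM; split=> [|||z|].
- by rewrite muln_gt0 W0.
- rewrite -(pair_big xpredT xpredT
    (fun i j => pi (gam j * gam i)^-1%g (pi (gam j) (Z i) + Z j)))/=.
  under eq_bigr => i _.
    under eq_bigr => l _ do rewrite invgM piM piD piV.
    under eq_bigr => l _ do rewrite piD.
    rewrite big_split /= -[X in _ + X]pi_sum Z0 pi0 addr0.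
    rewrite sumr_const.
    over.
  by rewrite sumrMnl Z0 mul0rn.
- rewrite -(pair_big xpredT xpredT
    (fun i j => `|pi (gam j) (Z i) + Z j| ^+ 2))/=.
  apply: (@le_trans _ _ (\sum_i 2 * (1 - d / 8) *
     (#|W|%:R * `|Z i| ^+ 2 + \sum_w `|Z w| ^+ 2))).
    apply: ler_sum => i _.
    (* Applying the isometry [pi (gam w)^-1] to the new endpoint leaves [Z i] plus a vector of mean
       zero in [w]. *)
    have := uniformly_convex_centered (Z i) d0 uc Z0.
    under [X in X <= _ -> _]eq_bigr => w _.
      rewrite -(pi_norm (gam w)) piD piVK. over.
    by under [X in _ <= _ * (_ + X) -> _]eq_bigr => w _ do rewrite pi_norm.
  rewrite -mulr_sumr big_split /= -mulr_sumr sumr_const.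
  pose c : R := 4 * (1 - d / 8); have c0 : 0 <= c := c_ge0.
  rewrite exprS; move: ZA; rewrite -/c; set S := \sum_i `|Z i| ^+ 2 => ZA.
  rewrite -(mulr_natl S).
  have -> : 2 * (1 - d / 8) * (#|W|%:R * S + #|W|%:R * S) = #|W|%:R * (c * S).
    by rewrite /c; ring.
  rewrite -mulrA ler_wpM2l ?(ltW n0)//.
  have -> : #|W|%:R * (c * c ^+ j * A) = c * (#|W|%:R * (c ^+ j * A)) by ring.
  by rewrite ler_wpM2l.
- rewrite -(pair_big xpredT xpredT (fun i j => f (pi (gam j * gam i)%g z)))/=.
  under eq_bigr => i _.
    under eq_bigr => l _ do rewrite piM.
    rewrite gf. over.
  by rewrite -mulr_sumr gf mulrA.
- rewrite -(pair_big xpredT xpredT (fun i j => f (pi (gam j) (Z i) + Z j)))/=.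
  under eq_bigr => i _.
    under eq_bigr => l _ do rewrite fD.
    rewrite big_split /= gf fZ. over.
  rewrite big_split /= -mulr_sumr fZ sumr_const -(mulr_natl (_ * _)) exprS; ring.
Qed.

Lemma martingale_block_iter e A j :
  martingale_block e A 0 -> martingale_block e A j.
Proof. by move=> blk; elim: j => // j; exact: martingale_block_double. Qed.

(** An increment [e > 0] of [f] would give, after [2 ^ j] steps, a martingale on which [f] has mean
    [2 ^ j * e]. Since [f] is bounded by the norm, this exceeds the mean square allowed by uniform
    convexity once [j] is large. *)
Lemma harmonic_functional_invariant (I : finType) (s : I -> G) :
  (forall z, \sum_i f (pi (s i) z) = #|I|%:R * f z) ->
  forall i z, f (pi (s i) z) = f z.
Proof.
move=> harm i0; suff le z : f (pi (s i0) z) <= f z => [z|].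
  apply/eqP; rewrite eq_le le /=.
  by have := le (- z); rewrite -(lerN2 (f (- z))) !(fN, opprK) piN fN opprK.
rewrite leNgt; apply/negP => fz.
pose e := f (pi (s i0) z) - f z; have e0 : 0 < e by rewrite subr_gt0.
have I0 : (0 < #|I|)%N by apply/card_gt0P; exists i0.
(* These vectors sum to zero, and by harmonicity the mean of [f (pi (s i) (y i))] is exactly [e]. *)
pose y i := z *+ (if i == i0 then #|I| else 0%N) - z.
have ifE (F : I -> E) : \sum_i F i *+ (if i == i0 then #|I| else 0%N)
   = F i0 *+ #|I|.
  rewrite (bigD1 i0)//= eqxx big1 ?addr0// => i /negPf ->.
  by rewrite mulr0n.
pose A := \sum_i `|pi (s i) (y i)| ^+ 2.
have A0 : 0 <= A by apply: sumr_ge0 => i _; rewrite sqr_ge0.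
have blk j : martingale_block e A j.
  apply: martingale_block_iter; exists I, s, (fun i => pi (s i) (y i)).
  split=> //.
  - under eq_bigr do rewrite piV.
    by rewrite /y sumrB ifE sumr_const subrr.
  - by rewrite expr0 mul1r ler_peMl// ler1n.
  - rewrite expr0 mul1r /y.
    under eq_bigr do rewrite piD piN piMn fD fN fMn.
    rewrite sumrB harm (bigD1 i0)//= eqxx big1 => [|i /negPf ->]; last first.
      by rewrite mulr0n.
    by rewrite addr0 /e -(mulr_natl (f _)) -mulrBr.
have small j : e ^+ 2 <= (1 - d / 8) ^+ j * A.
  have [W [gam [Z [W0 _ ZA _ fZ]]]] := blk j.
  pose t := 2 ^+ j * e; have t0 : 0 < t by rewrite mulr_gt0 ?exprn_gt0.
  have tZ : #|W|%:R * t ^+ 2 <= \sum_w `|Z w| ^+ 2.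
    (* Cauchy-Schwarz for means, through [2 t u <= t^2 + u^2], with [t] the mean of [f (Z w)]. *)
    have : \sum_w 2 * t * f (Z w) <= \sum_w (t ^+ 2 + `|Z w| ^+ 2).
      apply: ler_sum => w _.
      have h1 : f (Z w) <= `|Z w| by rewrite (le_trans (ler_norm _)).
      have h2 := sqr_ge0 (t - `|Z w|).
      by have := ler_wpM2l (ltW t0) h1; lra.
    rewrite -mulr_sumr fZ big_split /= sumr_const -(mulr_natl (t ^+ 2)) -/t.
    lra.
  have := le_trans tZ ZA; rewrite ler_pM2l ?ltr0n// /t !exprMn.
  have -> : 2 ^+ j ^+ 2 = 4 ^+ j :> R.
    by rewrite -exprM mulnC exprM; congr (_ ^+ _); ring.
  by rewrite -mulrA ler_pM2l ?exprn_gt0.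
have : (1 - d / 8) ^+ j * A @[j --> \oo] --> 0 * A.
  apply: cvgMr_tmp; apply: cvg_expr.
  by rewrite ger0_norm// gtrBl divr_gt0.
rewrite mul0r => /(@ler_cvg_to _ _ _ _ (cst (e ^+ 2)) _ _ _ (cvg_cst _)) le0.
have : e ^+ 2 <= 0 by apply: le0; exact: nearW.
by rewrite leNgt exprn_gt0.
Qed.

End HarmonicFunctional.

(** * Dominated additive functionals *)

Section DominatedFunctional.
Context {R : realType} {E : lmodType R}.

Definition sublinear (p : E -> R) : Prop :=
  (forall x y, p (x + y) <= p x + p y) /\
  (forall t x, 0 <= t -> p (t *: x) = t * p x).

Lemma sublinear0 p : sublinear p -> p 0 = 0.
Proof. by case=> _ /(_ 0 0 (lexx 0)); rewrite scale0r mul0r. Qed.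

Lemma sublinear_geN p x : sublinear p -> - p (- x) <= p x.
Proof.
move=> sp; have := sp.1 x (- x); rewrite subrr (sublinear0 sp); lra.
Qed.

(* The largest sublinear minorant of [p] taking the value [- p y] at [- y]. *)
Definition sublinear_along (p : E -> R) (y x : E) : R :=
  inf [set p (x + t *: y) - t * p y | t in [set t | 0 <= t]].

Lemma sublinear_along_lb p x y t : sublinear p -> 0 <= t ->
  - p (- x) <= p (x + t *: y) - t * p y.
Proof.
move=> sp t0; have := sp.1 (x + t *: y) (- x).
by rewrite addrAC subrr add0r sp.2//; lra.
Qed.

Lemma sublinear_along_le p y x t : sublinear p -> 0 <= t ->
  sublinear_along p y x <= p (x + t *: y) - t * p y.
Proof.
move=> sp t0; apply: ge_inf; last by exists t.
by exists (- p (- x)) => _ [u u0 <-]; exact: sublinear_along_lb.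
Qed.

Lemma sublinear_along_ge p y x c :
  (forall t, 0 <= t -> c <= p (x + t *: y) - t * p y) ->
  c <= sublinear_along p y x.
Proof.
move=> h; apply: lb_le_inf => [|_ [t t0 <-]]; last exact: h.
by exists (p (x + 0 *: y) - 0 * p y), 0 => /=.
Qed.

Lemma sublinear_along_le_self p y x : sublinear p -> sublinear_along p y x <= p x.
Proof.
by move=> sp; have := sublinear_along_le y x sp (lexx 0);
  rewrite scale0r addr0 mul0r subr0.
Qed.

Lemma sublinear_alongP p y : sublinear p -> sublinear (sublinear_along p y).
Proof.
move=> sp; split=> [x z|t x].
  rewrite -lerBlDl; apply: sublinear_along_ge => t t0.
  rewrite lerBlDl -lerBlDr; apply: sublinear_along_ge => u u0.
  have := sublinear_along_le y (x + z) sp (addr_ge0 t0 u0).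
  have := sp.1 (x + u *: y) (z + t *: y).
  by rewrite addrACA -scalerDl [u + t]addrC; lra.
rewrite le_eqVlt => /predU1P[<-|t0].
  rewrite scale0r mul0r; apply/eqP; rewrite eq_le.
  have := sublinear_along_le_self y 0 sp; rewrite (sublinear0 sp) => -> /=.
  by apply: sublinear_along_ge => u u0; rewrite add0r sp.2// subrr.
apply/eqP; rewrite eq_le; apply/andP; split.
  rewrite -ler_pdivrMl//; apply: sublinear_along_ge => u u0.
  rewrite ler_pdivrMl// mulrBr -(sp.2 t) ?(ltW t0)// scalerDr scalerA mulrA.
  by apply: sublinear_along_le => //; rewrite mulr_ge0// ltW//.
apply: sublinear_along_ge => u u0.
have tu0 : 0 <= u / t by rewrite divr_ge0// ltW.
have := ler_wpM2l (ltW t0) (sublinear_along_le y x sp tu0).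
rewrite mulrBr -(sp.2 t (_ + _)) ?(ltW t0)// scalerDr scalerA [t * (_ * p y)]mulrA.
by rewrite [t * (u / t)]mulrC divfK// gt_eqF.
Qed.

(** Zorn's lemma for the reversed pointwise order: the pointwise infimum of a chain of sublinear
    functions is again sublinear. *)
Lemma sublinear_minimal p : sublinear p ->
  exists2 q, sublinear q /\ (forall x, q x <= p x) &
    forall r, sublinear r -> (forall x, r x <= q x) -> r = q.
Proof.
move=> sp.
pose T := {q : E -> R | sublinear q /\ (forall x, q x <= p x)}.
pose ge (q r : T) := `[< forall x, sval r x <= sval q x >].
have [] := @Zorn T ge.
- by move=> q; apply/asboolP => x.
- move=> q r s /asboolP qr /asboolP rs; apply/asboolP => x.
  exact: le_trans (rs x) (qr x).
- move=> [q Pq] [r Pr] /asboolP /= rq /asboolP /= qr; apply: eq_exist.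
  by apply/funext => x; apply/eqP; rewrite eq_le qr rq.
- move=> A tot; have [[q0 Aq0]|A0] := pselect (A !=set0); last first.
    pose t : T := exist _ p (conj sp (fun x => lexx (p x))).
    exists t => s As.
    by case: A0; exists s.
  pose V x := [set sval q x | q in A].
  have V0 x : V x !=set0 by exists (sval q0 x), q0.
  have Vlb x : lbound (V x) (- sval q0 (- x)).
    move=> _ [q Aq <-].
    have [/asboolP qq|/asboolP qq] := tot _ _ Aq Aq0.
      apply: le_trans (qq x); exact: sublinear_geN (svalP q0).1.
    apply: le_trans (sublinear_geN _ (svalP q).1).
    by rewrite lerN2.
  have infle x q : A q -> inf (V x) <= sval q x.
    by move=> Aq; apply: ge_inf; [exists (- sval q0 (- x))|exists q].
  have si : sublinear (fun x => inf (V x)).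
    split=> [x y|t x t0].
      rewrite -lerBlDl; apply: lb_le_inf => // _ [q Aq <-].
      rewrite lerBlDl -lerBlDr; apply: lb_le_inf => // _ [r Ar <-].
      rewrite lerBlDl.
      (* Of two members of the chain the smaller one serves for both [x] and [y]. *)
      have [/asboolP qr|/asboolP qr] := tot _ _ Aq Ar.
        have := infle (x + y) _ Ar; have := (svalP r).1.1 x y.
        by have := qr y; lra.
      have := infle (x + y) _ Aq; have := (svalP q).1.1 x y.
      by have := qr x; lra.
    have [->|tn0] := eqVneq t 0.
      rewrite scale0r mul0r; apply/eqP; rewrite eq_le.
      rewrite -{1}(sublinear0 (svalP q0).1) infle//=.
      by apply: lb_le_inf => // _ [q _ <-]; rewrite (sublinear0 (svalP q).1).
    have {tn0}t0' : 0 < t by rewrite lt_neqAle eq_sym tn0.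
    apply/eqP; rewrite eq_le; apply/andP; split.
      rewrite -ler_pdivrMl//; apply: lb_le_inf => // _ [q Aq <-].
      by rewrite ler_pdivrMl// -(svalP q).1.2// infle.
    apply: lb_le_inf => // _ [q Aq <-].
    by rewrite (svalP q).1.2// ler_wpM2l// infle.
  have ip x : inf (V x) <= p x.
    exact: le_trans (infle x _ Aq0) ((svalP q0).2 x).
  pose t : T := exist _ (fun x => inf (V x)) (conj si ip).
  exists t => q Aq; apply/asboolP => x /=.
  exact: infle.
move=> [q [sq qp]] qmin; exists q => // r sr rq.
have rp x : r x <= p x := le_trans (rq x) (qp x).
pose t : T := exist _ r (conj sr rp).
by have /(_ (asboolT rq))/(congr1 sval) := qmin t.
Qed.

(** Hahn-Banach by minimality: a minimal sublinear [q] equals [sublinear_along q y] for every [y],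
    and evaluating the latter at [t = 1] gives [q x + q y <= q (x + y)]. *)
Lemma dominated_additive p : sublinear p ->
  exists2 f : E -> R, {morph f : x y / x + y} & forall x, f x <= p x.
Proof.
move=> /sublinear_minimal[q [sq qp] qmin]; exists q => // x y.
apply/eqP; rewrite eq_le sq.1/=.
have <- : sublinear_along q y x = q x.
  rewrite (qmin (sublinear_along q y))//; first exact: sublinear_alongP.
  by move=> z; exact: sublinear_along_le_self.
have := sublinear_along_le y x sq (@ler01 R).
by rewrite scale1r mul1r lerBrDr.
Qed.

End DominatedFunctional.

(** The dominating function is the norm modified along [v]; its value at [- v] is at most [- |v|],
    which forces [f v = |v|]. *)
Lemma norming_additive {R : realType} {E : normedModType R} (v : E) :
  exists f : E -> R,
    [/\ {morph f : x y / x + y}, forall x, `|f x| <= `|x| & f v = `|v|].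
Proof.
have sn : sublinear (fun x : E => `|x|).
  split=> [x y|t x t0]; first exact: ler_normD.
  by rewrite normrZ ger0_norm.
have [f fD fle] := dominated_additive (sublinear_alongP v sn).
have f0 : f 0 = 0 by apply: (@addrI _ (f 0)); rewrite -fD !addr0.
have fN x : f (- x) = - f x.
  by apply: (@addrI _ (f x)); rewrite -fD !subrr f0.
have fn x : f x <= `|x| := le_trans (fle x) (sublinear_along_le_self v x sn).
exists f; split=> // [x|].
  by rewrite ler_norml fn lerNl -fN -normrN fn.
apply/eqP; rewrite eq_le fn /= -lerN2 -fN (le_trans (fle _))//.
have := sublinear_along_le v (- v) sn (@ler01 R).
by rewrite scale1r addNr normr0 mul1r sub0r.
Qed.

(** * Ultralimits and invariant functionals *)

Section UltraLimit.
Context {R : realType} (U : set_system nat) (UF : UltraFilter U).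

Lemma bounded_ultra_cvg_norm (u : nat -> R) (C : R) :
  (forall n, `|u n| <= C) -> cvg (u @ U).
Proof.
move=> uC; have : cvg ((fun n => u n + C) @ U).
  apply: (@bounded_ultra_cvg _ _ UF _ (C + C)) => n.
  by have := uC n; rewrite ler_norml => /andP[]; lra.
move=> cv; have : cvg ((fun n => (u n + C) - C) @ U).
  by apply: is_cvgB => //; exact: is_cvg_cst.
by under eq_fun do rewrite addrK.
Qed.

Lemma ultra_cvg_unique (u : nat -> R) (l l' : R) :
  u @ U --> l -> u @ U --> l' -> l = l'.
Proof.
have PU : ProperFilter U := @ultra_proper _ _ UF.
by move=> h h'; exact: (@cvg_unique R (@norm_hausdorff R R) (u @ U) _ l l' h h').
Qed.

(** Removing points one at a time shows that no finite set belongs to [U], so every cofinite set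
    does. *)
Lemma nonprincipal_sub_eventually :
  (forall n, ~ U [set n]) -> \oo `<=` U.
Proof.
move=> np A [N _ NA].
have [//|UnA] := in_ultra_setVsetC A UF.
suff : forall m, ~ U (~` A `&` [set n | (n < m)%N]).
  move=> /(_ N)[]; apply: filterS UnA => n nA; split=> //=.
  by rewrite ltnNge; apply/negP => /NA.
elim=> [|m IH].
  move=> h; apply: (@filter_not_empty _ U).
  by apply: filterS h => n [].
move=> h; case: (in_ultra_setVsetC [set m] UF) => [/np//|Um].
apply: IH; apply: filterS (filterI h Um) => n [[nA] /=].
by rewrite ltnS leq_eqVlt => /predU1P[->|].
Qed.

Lemma cvg_eventually_ultra (u : nat -> R) (l : R) :
  \oo `<=` U -> u @ \oo --> l -> u @ U --> l.
Proof. by move=> ooU ul; apply: cvg_trans ul => A /= /ooU. Qed.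

End UltraLimit.

Section InvariantFunctional.
Context {R : realType} {E : normedModType R} {G : groupType}.
Variables (pi : G -> E -> E).
Hypotheses (piD : forall g, {morph pi g : x y / x + y})
  (piM : forall g h x, pi (g * h)%g x = pi g (pi h x))
  (pi1 : forall x, pi 1%g x = x)
  (pi_norm : forall g x, `|pi g x| = `|x|).
Context {I : finType} (s : I -> G).
Hypothesis I_gt0 : (0 < #|I|)%N.

(** Cesaro means of the iterates of the averaging operator, taken along an ultrafilter. Averaging
    once more changes the mean only by a telescoping term of order [1 / n]. *)
Lemma harmonic_functional_ex (v : E) (f : E -> R) :
  (forall i, pi (s i) v = v) ->
  {morph f : x y / x + y} -> (forall x, `|f x| <= `|x|) ->
  exists f' : E -> R,
    [/\ {morph f' : x y / x + y}, forall x, `|f' x| <= `|x|, f' v = f v &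
        forall z, \sum_i f' (pi (s i) z) = #|I|%:R * f' z].
Proof.
move=> piv fD fle; pose k : R := #|I|%:R.
have k0 : 0 < k by rewrite ltr0n.
(* [F n z] is the mean of [f] at the end of the [n]-step walk started at [z]; it is additive,
   bounded by the norm, and keeps the value at the fixed vector [v]. *)
pose F n := iter n (fun (h : E -> R) z => k^-1 * \sum_i h (pi (s i) z)) f.
have FS n z : F n.+1 z = k^-1 * \sum_i F n (pi (s i) z) by [].
have FD n : {morph F n : x y / x + y}.
  elim: n => [//|n IH] x y; rewrite !FS -mulrDr -big_split.
  by congr (_ * _); apply: eq_bigr => i _; rewrite piD IH.
have Fle n x : `|F n x| <= `|x|.
  elim: n x => [//|n IH] x; rewrite FS normrM gtr0_norm ?invr_gt0//.
  rewrite mulrC ler_pdivrMr// (le_trans (ler_norm_sum _ _ _))//.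
  rewrite mulrC mulr_natl -sumr_const; apply: ler_sum => i _.
  by rewrite -(pi_norm (s i) x).
have Fv n : F n v = f v.
  elim: n => [//|n IH]; rewrite FS (eq_bigr (fun=> f v)) => [|i _]; last first.
    by rewrite piv.
  by rewrite sumr_const -(mulr_natl (f v)) mulKf// gt_eqF.
pose av z n := n.+1%:R^-1 * \sum_(j < n.+1) F j z.
have n0 n : 0 < n.+1%:R :> R by rewrite ltr0n.
have av_le z n : `|av z n| <= `|z|.
  rewrite /av normrM gtr0_norm ?invr_gt0// mulrC ler_pdivrMr//.
  rewrite (le_trans (ler_norm_sum _ _ _))// mulrC mulr_natl.
  rewrite -[in leRHS](card_ord n.+1) -sumr_const.
  by apply: ler_sum => i _.
have [U [UF ooU]] := ultraFilterLemma (@eventually_filter).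
have PU : ProperFilter U := @ultra_proper _ _ UF.
pose f' z : R := lim (av z @ U).
have f'c z : av z @ U --> f' z.
  exact: (bounded_ultra_cvg_norm UF (av_le z)).
have uniq := @ultra_cvg_unique R U UF.
exists f'; split.
- move=> x y; apply: uniq (f'c _) _.
  rewrite (_ : av (x + y) = av x \+ av y); first exact: cvgD (f'c x) (f'c y).
  apply/funext => n; rewrite /= /av -mulrDr -big_split.
  by congr (_ * _); apply: eq_bigr => i _; rewrite FD.
- move=> x; rewrite ler_norml; apply/andP; split.
    apply: limr_ge; [exact: f'c|apply: nearW => n].
    by have := av_le x n; rewrite ler_norml => /andP[].
  apply: limr_le; [exact: f'c|apply: nearW => n].
  by have := av_le x n; rewrite ler_norml => /andP[].
- apply: uniq (f'c _) _.
  rewrite (_ : av v = fun=> f v); first exact: cvg_cst.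
  apply/funext => n; rewrite /av; under eq_bigr do rewrite Fv.
  by rewrite sumr_const card_ord -(mulr_natl (f v)) mulKf// gt_eqF.
- move=> z.
  have small : (fun n => k * (n.+1%:R^-1 * (F n.+1 z - F 0%N z))) @ U --> 0.
    apply: (cvg_eventually_ultra ooU).
    have h0 : (fun n => 2 * k * `|z| * n.+1%:R^-1 : R) @ \oo --> 0.
      rewrite -[0 in X in _ --> X](mulr0 (2 * k * `|z|)); apply: cvgMl_tmp.
      exact: cvg_harmonic.
    apply/norm_cvg0P; apply: squeeze_cvgr (cvg_cst 0) h0.
    apply: nearW => n; rewrite normr_ge0 /= !normrM gtr0_norm//.
    rewrite gtr0_norm ?invr_gt0//.
    have := ler_normB (F n.+1 z) (F 0%N z).
    have := Fle n.+1 z; have := Fle 0%N z => h1 h2 h3.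
    have h4 : `|F n.+1 z - F 0%N z| <= 2 * `|z| by lra.
    rewrite [leRHS](_ : _ = k * (n.+1%:R^-1 * (2 * `|z|))); last by ring.
    by rewrite ler_wpM2l ?(ltW k0)// ler_wpM2l// invr_ge0 ltW.
  apply: (uniq (fun n => \sum_i av (pi (s i) z) n)).
    by apply: cvg_big => [|i _]; [exact: add_continuous|exact: f'c].
  rewrite (_ : (fun n => _) = fun n =>
      k * av z n + k * (n.+1%:R^-1 * (F n.+1 z - F 0%N z))).
    rewrite -[k * f' z]addr0; apply: cvgD small.
    exact: cvgMl_tmp (f'c z).
  apply/funext => n.
  rewrite /av -mulr_sumr exchange_big /=.
  rewrite (eq_bigr (fun j : 'I_n.+1 => k * F j.+1 z)) => [|j _]; last first.
    by rewrite FS mulVKf// gt_eqF.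
  rewrite -mulr_sumr.
  have -> : \sum_(j < n.+1) F j.+1 z =
      \sum_(j < n.+1) F j z + (F n.+1 z - F 0%N z).
    rewrite big_ord_recr [in RHS]big_ord_recl.
    under [in RHS]eq_bigr do rewrite lift0.
    rewrite /=.
    ring.
  by rewrite mulrCA -mulrDr -mulrDr.
Qed.

Lemma invariant_functional_ex (d : R) (v : E) :
  0 < d -> 0 <= 1 - d / 8 -> @uniformly_convex_with R E d ->
  (forall i, pi (s i) v = v) ->
  exists f : E -> R,
    [/\ {morph f : x y / x + y}, forall x, `|f x| <= `|x|, f v = `|v| &
        forall i z, f (pi (s i) z) = f z].
Proof.
move=> d0 d8 uc piv.
have [f0 [f0D f0le f0v]] := norming_additive v.
have [f [fD fle fv harm]] := harmonic_functional_ex piv f0D f0le.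
exists f; split=> //; first by rewrite fv.
exact: (harmonic_functional_invariant d0 d8 uc piD piM pi1 pi_norm fD fle harm).
Qed.

End InvariantFunctional.

(** * Midpoints and parallel segments *)

Section Midpoints.
Context {R : realType} {X : metricType R}.
Implicit Types x y z m : X.

Local Notation mid := (ratio_pt 2^-1).

Lemma mid_dist x y : geodesic_space X ->
  mdist x (mid x y) = mdist x y / 2 /\ mdist (mid x y) y = mdist x y / 2.
Proof.
move=> gX; have [c gc] := gX x y; rewrite /ratio_pt; set S := [set z | _].
have [c' gc' ->] : S (xget x S).
  by apply: (@xgetPex _ x S); exists (c (2^-1 * mdist x y)), c.
have d0 := mdist_ge0 x y.
have [_ c0 c1 cd] := gc'.
have h0 : 0 <= (0 : R) <= mdist x y by apply/andP; split.
have h1 : 0 <= mdist x y <= mdist x y by apply/andP; split.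
have h2 : 0 <= 2^-1 * mdist x y <= mdist x y by apply/andP; split; lra.
split.
  by rewrite -[X in mdist X _]c0 cd// ler0_norm; lra.
by rewrite -[X in mdist _ X]c1 cd// ler0_norm; lra.
Qed.

(** For points on different halves, the triangle inequality through [m] bounds their distance above,
    and the one along [x], the two points and [y] bounds it below by the same number. *)
Lemma geodesic_concat_half x m y c1 c2 :
  mdist x m = mdist x y / 2 -> mdist m y = mdist x y / 2 ->
  geodesic (mdist x m) x m c1 -> geodesic (mdist m y) m y c2 ->
  geodesic (mdist x y) x y (concat_path (mdist x y / 2) c1 c2).
Proof.
move=> -> ->; set l := mdist x y; have l0 : 0 <= l := mdist_ge0 x y.
move=> [_ c10 c1l c1d] [_ c20 c2l c2d].
have mix s t : 0 <= s -> s <= l / 2 -> l / 2 <= t -> t <= l ->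
    mdist (c1 s) (c2 (t - l / 2)) = t - s.
  move=> s0 s1 t0 t1.
  have hs : 0 <= s <= l / 2 by rewrite s0.
  have ht : 0 <= t - l / 2 <= l / 2 by apply/andP; split; lra.
  have z0 : 0 <= (0 : R) <= l / 2 by apply/andP; split; lra.
  have zl : 0 <= l / 2 <= l / 2 by apply/andP; split; lra.
  have e1 : mdist x (c1 s) = s by rewrite -c10 c1d// ler0_norm; lra.
  have e2 : mdist (c1 s) m = l / 2 - s by rewrite -c1l c1d// ler0_norm; lra.
  have e3 : mdist m (c2 (t - l / 2)) = t - l / 2.
    by rewrite -{1}c20 c2d// ler0_norm; lra.
  have e4 : mdist (c2 (t - l / 2)) y = l - t by rewrite -c2l c2d// ler0_norm; lra.
  have t1' := metric_triangle x (c1 s) y.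
  have t2 := metric_triangle (c1 s) (c2 (t - l / 2)) y.
  have t3 := metric_triangle (c1 s) m (c2 (t - l / 2)).
  by apply/eqP; rewrite eq_le; apply/andP; split; rewrite /l in e1 e2 e3 e4 *; lra.
split=> //; rewrite /concat_path.
- by rewrite c10 ifT//; lra.
- case: ifPn => [h|_]; last by rewrite (_ : l - l / 2 = l / 2) ?c2l//; lra.
  (* The test in [concat_path] succeeds at the right end only for a segment of length zero. *)
  have le0 : l = 0 by lra.
  rewrite -c2l -[RHS](congr1 c2 (_ : 0 = l / 2)); last by lra.
  by rewrite c20 -c1l; congr c1; lra.
move=> s t /andP[s0 s1] /andP[t0 t1].
case: (leP s (l / 2)) => hs; case: (leP t (l / 2)) => ht.
- by rewrite c1d// ?s0 ?t0.
- by rewrite mix//; [rewrite ler0_norm; lra|lra].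
- by rewrite metric_sym mix//; [rewrite ger0_norm; lra|lra].
- rewrite c2d; [congr (`|_|); ring| |]; apply/andP; split; lra.
Qed.

(** Geodesics from [x] to [m] and from [m] to [y] concatenate to a geodesic, which must be the
    unique one; so [m] is its middle point. *)
Lemma mid_unique x y m : uniquely_geodesic X ->
  mdist x m = mdist x y / 2 -> mdist m y = mdist x y / 2 -> m = mid x y.
Proof.
move=> [gX uX] xm my; have [c1 g1] := gX x m; have [c2 g2] := gX m y.
have gc := geodesic_concat_half xm my g1 g2.
rewrite /ratio_pt; set S := [set z | _].
have [c' gc' ->] : S (xget x S).
  apply: (@xgetPex _ x S).
  by exists (concat_path (mdist x y / 2) c1 c2 (2^-1 * mdist x y)),
     (concat_path (mdist x y / 2) c1 c2).
have d0 := mdist_ge0 x y.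
rewrite -(uX _ _ _ _ gc gc'); last by apply/andP; split; lra.
rewrite [2^-1 * _]mulrC /concat_path lexx -xm.
by case: g1.
Qed.

Lemma mid_isometry (g : X -> X) x y : uniquely_geodesic X ->
  (forall a b, mdist (g a) (g b) = mdist a b) ->
  mid (g x) (g y) = g (mid x y).
Proof.
move=> uX gi; have [h1 h2] := mid_dist x y uX.1.
by apply/esym/mid_unique => //; rewrite !gi.
Qed.

Lemma parallel_seg_sym x y x' y' :
  parallel_seg x y x' y' -> parallel_seg x' y' x y.
Proof.
by rewrite /parallel_seg [mdist x' x]metric_sym [mdist y' y]metric_sym
  [mdist (mid x' y') _]metric_sym.
Qed.

Lemma parallel_seg_isometry (g : X -> X) x y x' y' : uniquely_geodesic X ->
  (forall a b, mdist (g a) (g b) = mdist a b) ->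
  parallel_seg x y x' y' -> parallel_seg (g x) (g y) (g x') (g y').
Proof. by move=> uX gi [h1 h2]; split; rewrite ?mid_isometry// !gi. Qed.

Lemma parallel_seg_refl x y : parallel_seg x y x y.
Proof. by split; rewrite !mdistxx. Qed.

End Midpoints.

(** * Subgroups, and groups generated by [M] and [L] *)

Section Subgroups.
Context {G : groupType}.

Lemma subgroup_closure_ind (A P : set G) :
  A `<=` P -> P 1%g -> (forall g h, P g -> P h -> P (g * h)%g) ->
  (forall g, P g -> P g^-1%g) -> subgroup_closure A `<=` P.
Proof.
move=> AP P1 PM PV; apply: smallest_sub => //; split.
  by rewrite inE.
by move=> x y; rewrite !inE => Px Py; apply: PM => //; exact: PV.
Qed.

Lemma subgroup1 (H : set G) : is_subgroup H -> H 1%g.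
Proof. by case=> + _; rewrite inE. Qed.

Lemma subgroupM (H : set G) x y : is_subgroup H -> H x -> H y -> H (x * y)%g.
Proof.
by move=> /group_closedM HM Hx Hy; rewrite -in_setE; apply: HM; rewrite inE.
Qed.

Lemma subgroupX (H : set G) x n : is_subgroup H -> H x -> H (x ^+ n)%g.
Proof.
move=> sH Hx; elim: n => [|n IH]; first by rewrite expg0; exact: subgroup1.
by rewrite expgS; exact: subgroupM.
Qed.

End Subgroups.

Section GeneratingPair.
Context {R : realType} {G : groupType}.
Variables (M L : set G).
Hypotheses (M_sub : is_subgroup M) (L_sub : is_subgroup L)
  (ML_gen : subgroup_closure (M `|` L) = [set: G]).

Lemma generated_ind (P : set G) :
  M `<=` P -> L `<=` P -> (forall g h, P g -> P h -> P (g * h)%g) ->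
  (forall g, P g -> P g^-1%g) -> forall g, P g.
Proof.
move=> MP LP PM PV g; have : [set: G] g by [].
rewrite -ML_gen; apply: subgroup_closure_ind => //.
  by move=> x [/MP|/LP].
by apply: MP; exact: subgroup1.
Qed.

(** On a subgroup a bounded morphism to the reals vanishes, since [psi (g ^+ n)] is [n] times
    [psi g]; vanishing then spreads from [M] and [L] to [G]. *)
Lemma bounded_morphism_eq0 (psi : G -> R) (C : R) :
  (forall g h, psi (g * h)%g = psi g + psi h) ->
  (forall g, M g -> `|psi g| <= C) -> (forall g, L g -> `|psi g| <= C) ->
  forall g, psi g = 0.
Proof.
move=> psiM psiMC psiLC.
have psi1 : psi 1%g = 0.
  by apply: (@addrI _ (psi 1%g)); rewrite -psiM mulg1 addr0.
have psiX g n : psi (g ^+ n)%g = psi g *+ n.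
  by elim: n => [|n IH]; rewrite ?expg0 ?psi1// expgS psiM IH mulrS.
have van (H : set G) : is_subgroup H -> (forall g, H g -> `|psi g| <= C) ->
    forall g, H g -> psi g = 0.
  move=> sH HC g Hg; apply/eqP; rewrite -normr_eq0 eq_le normr_ge0 andbT.
  rewrite leNgt; apply/negP => pg.
  have C0 : 0 <= C := le_trans (normr_ge0 _) (HC _ Hg).
  have := HC _ (subgroupX (Num.bound (C / `|psi g|)) sH Hg).
  rewrite psiX normrMn -mulr_natl -ler_pdivlMr// leNgt => /negP; apply.
  by apply: archi_boundP; rewrite divr_ge0.
apply: generated_ind => [g|g|g h pg ph|g pg].
- exact: van.
- exact: van.
- by rewrite psiM pg ph addr0.
- by apply: (@addrI _ (psi g)); rewrite -psiM mulgV psi1 pg addr0.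
Qed.

Context {X : metricType R} (al : G -> X -> X).
Hypothesis act : isometric_action al.

(** The midpoints of [[x, h x]] and [[y, h y]] are fixed by [M] and [L], so minimality makes these
    segments parallel. As [M] fixes the first and [L] the second, transitivity makes [[x, h x]]
    parallel to its translates by [M] and [L], hence by [G]. *)
Lemma minimal_pair_parallel (x y : X) (h : G) :
  NPC1 X -> NPC2 X -> TP X ->
  fixed_points al M x -> fixed_points al L y ->
  (forall x' y', fixed_points al M x' -> fixed_points al L y' ->
     mdist x y <= mdist x' y') ->
  fixed_points al M (al h x) -> fixed_points al L (al h y) ->
  mdist x (al h x) = mdist y (al h y) /\
  forall g, parallel_seg x (al h x) (al g x) (al g (al h x)).
Proof.
case: (act) => a1 aM ai [uX n1] n2 tp Mx Ly xymin Mhx Lhy.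
have fixmid K a b : fixed_points al K a -> fixed_points al K b ->
    fixed_points al K (ratio_pt 2^-1 a b).
  by move=> Ka Kb g Kg; rewrite -(mid_isometry _ _ uX (ai g)) Ka// Kb.
have par : parallel_seg x (al h x) y (al h y).
  have xh : mdist x y = mdist (al h x) (al h y) by rewrite ai.
  have h2 : 0 <= (2^-1 : R) <= 1 by apply/andP; split; lra.
  (* One inequality between the midpoints is [NPC1], the other is minimality of the pair. *)
  split=> //; apply/eqP; rewrite -xh eq_le [X in _ && X]n1// andbT.
  by apply: xymin; apply: fixmid.
split; first by case: (n2 _ _ _ _ par).
apply: generated_ind => [g Mg|g Lg|g g' pg pg'|g pg].
- by rewrite (Mx _ Mg) (Mhx _ Mg); exact: parallel_seg_refl.
- have := parallel_seg_isometry uX (ai g) par.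
  by rewrite (Ly _ Lg) (Lhy _ Lg) => /parallel_seg_sym; exact: tp.
- rewrite !aM; apply: tp pg _.
  exact: parallel_seg_isometry.
- have := parallel_seg_isometry uX (ai g^-1%g) pg.
  have aV z : al g^-1%g (al g z) = z by rewrite -aM mulVg a1.
  by rewrite !aV => /parallel_seg_sym.
Qed.

End GeneratingPair.

(** * Translations in CAT(0) spaces *)

(** The additivity defect is of order [1 / n], so it disappears in an ultralimit; boundedness makes
    the limit exist. *)
Lemma asymptotic_morphism_limit {R : realType} {G : groupType}
  (u : nat -> G -> R) (B : G -> R) (C : G -> G -> R) :
  (forall n g, `|u n g| <= B g) ->
  (forall n g h, `|u n (g * h)%g - (u n g + u n h)| <= C g h * n.+1%:R^-1) ->
  exists psi : G -> R,
    [/\ forall g h, psi (g * h)%g = psi g + psi h, forall g, `|psi g| <= B g &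
        forall g c, (forall n, u n g = c) -> psi g = c].
Proof.
move=> uB uC; have [U [UF ooU]] := ultraFilterLemma (@eventually_filter).
have PU : ProperFilter U := @ultra_proper _ _ UF.
pose psi g : R := lim ((u^~ g) @ U).
have psic g : u^~ g @ U --> psi g.
  exact: (bounded_ultra_cvg_norm UF (fun n => uB n g)).
have uniq := @ultra_cvg_unique R U UF.
exists psi; split=> [g h|g|g c gc].
- have small : (fun n => u n (g * h)%g - (u n g + u n h)) @ U --> 0.
    apply: (cvg_eventually_ultra ooU).
    have h0 : (fun n => C g h * n.+1%:R^-1 : R) @ \oo --> 0.
      rewrite -[0 in X in _ --> X](mulr0 (C g h)); apply: cvgMl_tmp.
      exact: cvg_harmonic.
    apply/norm_cvg0P; apply: squeeze_cvgr (cvg_cst 0) h0.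
    by apply: nearW => n; rewrite normr_ge0 /= uC.
  have dif : (fun n => u n (g * h)%g - (u n g + u n h)) @ U -->
      psi (g * h)%g - (psi g + psi h).
    by apply: cvgB; [exact: psic|apply: cvgD; exact: psic].
  by apply/eqP; rewrite -subr_eq0 (uniq _ _ _ dif small).
- rewrite ler_norml; apply/andP; split.
    apply: limr_ge; [exact: psic|apply: nearW => n].
    by have := uB n g; rewrite ler_norml => /andP[].
  apply: limr_le; [exact: psic|apply: nearW => n].
  by have := uB n g; rewrite ler_norml => /andP[].
- apply: uniq (psic g) _.
  rewrite (_ : u^~ g = fun=> c); first exact: cvg_cst.
  exact/funext.
Qed.

Section CAT0.
Context {R : realType}.

(** Comparison triangle with vertices [(0, 0)], [(a, 0)] and [(u, v)]; the abscissa [u] comes from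
    the law of cosines. *)
Lemma plane_triangle_ex (a b c : R) :
  0 <= a -> 0 <= b -> 0 <= c -> a <= b + c -> b <= a + c -> c <= a + b ->
  exists u v : R, u ^+ 2 + v ^+ 2 = c ^+ 2 /\ (u - a) ^+ 2 + v ^+ 2 = b ^+ 2.
Proof.
move=> a0 b0 c0 abc bac cab; have [aE|an0] := eqVneq a 0.
  have -> : b = c by rewrite aE in bac cab *; lra.
  by exists c, 0; rewrite aE subr0 expr0n /= addr0.
have {an0}a_gt0 : 0 < a by rewrite lt_neqAle eq_sym an0.
pose u := (a ^+ 2 + c ^+ 2 - b ^+ 2) / (2 * a).
have au : 2 * a * u = a ^+ 2 + c ^+ 2 - b ^+ 2.
  by rewrite /u mulrC divfK// mulf_neq0// gt_eqF.
have uc : u ^+ 2 <= c ^+ 2.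
  have h1 : 2 * a * u <= 2 * a * c by rewrite au; nra.
  have h2 : 2 * a * - c <= 2 * a * u by rewrite au; nra.
  move: h1 h2; rewrite !ler_pM2l ?mulr_gt0// => h1 h2.
  nra.
exists u, (Num.sqrt (c ^+ 2 - u ^+ 2)); rewrite sqr_sqrtr ?subr_ge0//.
by split; [ring|rewrite sqrrB; lra].
Qed.

Context {X : metricType R}.
Hypotheses (catX : is_CAT0 X).

(** The Bruhat-Tits inequality, by comparison with the median of an explicit plane triangle. *)
Lemma CAT0_mid (p y z : X) :
  mdist p (ratio_pt 2^-1 y z) ^+ 2 <=
    mdist p y ^+ 2 / 2 + mdist p z ^+ 2 / 2 - mdist y z ^+ 2 / 4.
Proof.
have [gX cat] := catX; have [c gc] := gX y z.
rewrite /ratio_pt; set S := [set z | _].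
have [cyz gyz ->] : S (xget y S).
  by apply: (@xgetPex _ y S); exists (c (2^-1 * mdist y z)), c.
have [czp gzp] := gX z p; have [cpy gpy] := gX p y.
have t1 := metric_triangle y p z; have t2 := metric_triangle z y p.
have t3 := metric_triangle p z y.
rewrite !(metric_sym y p) !(metric_sym z y) !(metric_sym p z) in t1 t2 t3.
have [|||u [v [uvc uvb]]] := plane_triangle_ex (mdist_ge0 y z)
  (mdist_ge0 z p) (mdist_ge0 p y); try lra.
set a := mdist y z in uvc uvb *.
have pd (s t : R^o * R^o) r : 0 <= r ->
    (s.1 - t.1) ^+ 2 + (s.2 - t.2) ^+ 2 = r ^+ 2 -> plane_dist s t = r.
  by move=> r0 st; rewrite /plane_dist st sqrtr_sqr ger0_norm.
have xy : plane_dist (0, 0) (a, 0) = a.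
  by apply: pd; rewrite ?mdist_ge0//=; ring.
have yz : plane_dist (a, 0) (u, v) = mdist z p.
  by apply: pd; rewrite ?mdist_ge0//= -uvb; ring.
have zx : plane_dist (u, v) (0, 0) = mdist p y.
  by apply: pd; rewrite ?mdist_ge0//= -uvc; ring.
have := cat y z p cyz czp cpy _ _ _ gyz gzp gpy xy yz zx.
pose m' : R^o * R^o := (2^-1 * a, 0).
have h1 : 0 <= (0 : R) <= 1 by apply/andP; split.
have h2 : 0 <= (2^-1 : R) <= 1 by apply/andP; split; lra.
move=> /(_ p (cyz (2^-1 * a)) (u, v) m') H.
have le : mdist p (cyz (2^-1 * a)) <= plane_dist (u, v) m'.
  apply: H.
  - constructor 3; exists 0; split=> //.
      by rewrite mul0r; case: gpy.
    by rewrite subr0 scale1r scale0r addr0.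
  - constructor 1; exists 2^-1; split=> //.
    by congr (_, _); rewrite /= !scaler0 add0r.
apply: (@le_trans _ _ (plane_dist (u, v) m' ^+ 2)).
  by rewrite lerXn2r// nnegrE ?mdist_ge0 ?sqrtr_ge0.
rewrite /plane_dist sqr_sqrtr ?addr_ge0 ?sqr_ge0//=.
rewrite -uvc (metric_sym p z) -uvb; lra.
Qed.

(** Apply the median inequality from [a] and from [c] to the midpoint of [[b, d]], and bound the
    diagonal [[a, c]] by passing through it. *)
Lemma CAT0_quadrilateral (a b c d : X) :
  mdist a c ^+ 2 + mdist b d ^+ 2 <=
  mdist a b ^+ 2 + mdist b c ^+ 2 + mdist c d ^+ 2 + mdist d a ^+ 2.
Proof.
have ha := CAT0_mid a b d; have hc := CAT0_mid c b d.
set m := ratio_pt _ _ _ in ha hc.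
have tri := metric_triangle a m c; rewrite (metric_sym m c) in tri.
have tri2 : mdist a c ^+ 2 <= (mdist a m + mdist c m) ^+ 2.
  by rewrite lerXn2r// nnegrE ?addr_ge0 ?mdist_ge0.
have sq := sqr_ge0 (mdist a m - mdist c m).
by rewrite (metric_sym d a) (metric_sym b c); lra.
Qed.

(* Twice the Berg-Nikolaev quasi-inner product of the vectors [ab] and [cd]. *)
Definition quasi_inner (a b c d : X) : R :=
  mdist a d ^+ 2 + mdist b c ^+ 2 - mdist a c ^+ 2 - mdist b d ^+ 2.

(** The two bounds are the quadrilateral inequality for the cyclic orders [a b d c] and
    [a b c d]. *)
Lemma quasi_inner_le a b c d :
  `|quasi_inner a b c d| <= mdist a b ^+ 2 + mdist c d ^+ 2.
Proof.
have h1 := CAT0_quadrilateral a b d c; have h2 := CAT0_quadrilateral a b c d.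
rewrite /quasi_inner ler_norml; apply/andP; split.
  by rewrite (metric_sym d a) in h2; lra.
by rewrite (metric_sym d c) (metric_sym c a) in h1; lra.
Qed.

Lemma quasi_innerD a b c d e :
  quasi_inner a b c d + quasi_inner a b d e = quasi_inner a b c e.
Proof. by rewrite /quasi_inner; ring. Qed.

Lemma quasi_innerDl a b e c d :
  quasi_inner a b c d + quasi_inner b e c d = quasi_inner a e c d.
Proof. by rewrite /quasi_inner; ring. Qed.

End CAT0.

(** * Powers of an element translating parallel segments *)

Section ParallelTranslation.
Context {R : realType} {G : groupType} {X : metricType R}.
Variables (al : G -> X -> X) (x : X) (h : G).
Hypotheses (act : isometric_action al) (npc1 : NPC1 X) (npc2 : NPC2 X)
  (npc3 : NPC3 X) (tp : TP X).
Hypothesis par : forall g, parallel_seg x (al h x) (al g x) (al g (al h x)).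

Let a1 z : al 1%g z = z. Proof. by case: act. Qed.
Let aM g k z : al (g * k)%g z = al g (al k z). Proof. by case: act. Qed.
Let ai g z z' : mdist (al g z) (al g z') = mdist z z'.
Proof. by case: act. Qed.

Local Notation hx n := (al (h ^+ n)%g x).

(** By [NPC2] it suffices to show that [[x, g x]] is parallel to [[h^n x, g h^n x]], and these
    parallelisms chain by [TP] as [n] grows. *)
Lemma parallel_power n g : parallel_seg x (hx n) (al g x) (al g (hx n)).
Proof.
apply: npc2; elim: n => [|n IH].
  by rewrite expg0 a1; exact: parallel_seg_refl.
apply: tp IH _; apply: npc2; rewrite expgSr !aM.
have := par (g * (h ^+ n))%g; rewrite !aM; apply: tp.
exact: parallel_seg_sym (par _).
Qed.

Lemma power_displacement n g : mdist (hx n) (al g (hx n)) = mdist x (al g x).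
Proof. by case: (parallel_power n g). Qed.

Lemma power_dist_le n : mdist x (hx n) <= n%:R * mdist x (al h x).
Proof.
elim: n => [|n IH]; first by rewrite expg0 a1 mdistxx mul0r.
have := metric_triangle x (hx n) (hx n.+1).
by rewrite [in X in _ <= _ + X -> _]expgSr aM ai -natr1 mulrDl mul1r; lra.
Qed.

(** For [N = 2 ^ j], the segment [[x, h^N x]] is parallel to its translate by [h^N], which starts
    where it ends; by [NPC3] the two form a geodesic, so the length doubles. *)
Lemma power_dist_pow2 j :
  mdist x (hx (2 ^ j)) = (2 ^ j)%:R * mdist x (al h x).
Proof.
elim: j => [|j IH]; first by rewrite expn0 expg1 mul1r.
have := parallel_power (2 ^ j) (h ^+ (2 ^ j))%g.
rewrite -aM -expgD addnn -mul2n -expnS => p.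
have [gX _] := npc1.1.
have [c1 g1] := gX x (hx (2 ^ j)).
have [c2 g2] := gX (hx (2 ^ j)) (hx (2 ^ j.+1)).
have [l0 c0 cl cd] := npc3 p g1 g2.
have z0 : 0 <= (0 : R) <= mdist x (hx (2 ^ j)) + mdist (hx (2 ^ j)) (hx (2 ^ j.+1)).
  by rewrite lexx.
have zl : 0 <= mdist x (hx (2 ^ j)) + mdist (hx (2 ^ j)) (hx (2 ^ j.+1)) <=
    mdist x (hx (2 ^ j)) + mdist (hx (2 ^ j)) (hx (2 ^ j.+1)).
  by rewrite l0 lexx.
have := cd _ _ z0 zl; rewrite c0 cl sub0r normrN ger0_norm// => ->.
rewrite [in X in _ + X]expnS mul2n -addnn expgD aM ai IH expnS natrM; ring.
Qed.

(** The lower bound compares [n] with [2 ^ n]: a shortfall at [n] could not be recovered in the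
    remaining [2 ^ n - n] steps. *)
Lemma power_dist n : mdist x (hx n) = n%:R * mdist x (al h x).
Proof.
apply/eqP; rewrite eq_le power_dist_le /=.
have nle : (n <= 2 ^ n)%N by rewrite ltnW// ltn_expl.
have := metric_triangle x (hx n) (hx (2 ^ n)).
rewrite power_dist_pow2 -[in X in _ <= _ + X -> _](subnKC nle) expgD aM ai.
have := power_dist_le (2 ^ n - n); rewrite natrB// mulrBl; lra.
Qed.

Lemma CAT0_parallel_translation_trivial (M L : set G) (y : X) :
  is_CAT0 X -> is_subgroup M -> is_subgroup L ->
  subgroup_closure (M `|` L) = [set: G] ->
  fixed_points al M x -> fixed_points al L y -> al h x = x.
Proof.
move=> cat sM sL gen Mx Ly; set r := mdist x (al h x).
pose u n g := quasi_inner x (al g x) x (hx n.+1) / n.+1%:R.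
pose B g := mdist x (al g x) ^+ 2 + r ^+ 2.
have n0 n : 0 < n.+1%:R :> R by rewrite ltr0n.
(* The segment from [x] to [h^(n+1) x] is split into [n + 1] steps of length [r], each contributing
   at most [B g]. *)
have uB n g : `|u n g| <= B g.
  rewrite /u normrM [`|_^-1|]gtr0_norm ?invr_gt0// ler_pdivrMr//.
  elim: (n.+1) => [|m IH].
    rewrite expg0 a1 (_ : quasi_inner _ _ _ _ = 0) ?normr0 ?mulr0//.
    by rewrite /quasi_inner; ring.
  rewrite -(quasi_innerD _ _ _ (hx m)) (le_trans (ler_normD _ _))//.
  rewrite -natr1 mulrDr mulr1 lerD// (le_trans (quasi_inner_le cat _ _ _ _))//.
  by rewrite /B expgSr aM ai.
have iso g a b c d :
    quasi_inner (al g a) (al g b) (al g c) (al g d) = quasi_inner a b c d.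
  by rewrite /quasi_inner !ai.
pose C g k : R := 2 * (mdist x (al k x) ^+ 2 + mdist x (al g x) ^+ 2).
(* After translating the term of [k] by [g], the defect involves only the short segments [[x, g x]]
   and [[h^n x, g h^n x]], of equal length; it is therefore bounded before division. *)
have uC n g k : `|u n (g * k)%g - (u n g + u n k)| <= C g k * n.+1%:R^-1.
  rewrite /u -mulrDl -mulrBl normrM [`|_^-1|]gtr0_norm ?invr_gt0//.
  rewrite ler_wpM2r ?invr_ge0 ?(ltW (n0 n))//.
  rewrite -(iso g x (al k x)) -!aM.
  rewrite -(quasi_innerDl x (al g x) (al (g * k)%g x)).
  rewrite [X in X - _]addrC addrKA.
  have -> : forall a b c d : X, quasi_inner a b x c - quasi_inner a b (al g x) d
     = quasi_inner a b x (al g x) - quasi_inner a b c d.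
    by move=> a b c d; rewrite /quasi_inner; ring.
  rewrite (le_trans (ler_normB _ _))// /C.
  have b1 := quasi_inner_le cat (al g x) (al (g * k)%g x) x (al g x).
  have b2 := quasi_inner_le cat (al g x) (al (g * k)%g x) (hx n.+1)
    (al (g * h ^+ n.+1)%g x).
  rewrite [X in _ + X ^+ 2](_ : _ = mdist x (al g x)) in b2; last first.
    by rewrite aM power_displacement.
  by rewrite [al (g * k)%g x]aM ai in b1 b2 *; lra.
have [psi [psiM psiB psic]] := asymptotic_morphism_limit uB uC.
have psi0 : psi h = 0.
  apply: (bounded_morphism_eq0 sM sL gen (C := (2 * mdist x y) ^+ 2 + r ^+ 2)) => //.
    move=> g Mg; apply: le_trans (psiB g) _.
    by rewrite /B Mx// mdistxx expr0n /= lerD2r sqr_ge0.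
  move=> g Lg; apply: le_trans (psiB g) _; rewrite /B lerD2r.
  rewrite lerXn2r ?nnegrE ?mulr_ge0 ?mdist_ge0//.
  have := metric_triangle x y (al g x).
  by rewrite -{2}(Ly _ Lg) ai (metric_sym y x); lra.
(* The orbit of [h] has exact distances, so the sequence is constant:
   [((n+1)^2 + 1 - n^2) r^2 = 2 (n+1) r^2]. *)
have psih : psi h = 2 * r ^+ 2.
  apply: psic => n; rewrite /u /quasi_inner mdistxx power_dist.
  rewrite [in mdist (al h x) (hx _)]expgS aM ai power_dist -/r (metric_sym _ x) -/r.
  apply: (@mulIf _ n.+1%:R); first by rewrite gt_eqF.
  by rewrite divfK ?gt_eqF// -natr1; ring.
move: psi0; rewrite psih => /eqP.
rewrite mulf_eq0 pnatr_eq0 /= expf_eq0 /= => /eqP r0.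
by apply/esym/mdist_positivity.
Qed.

End ParallelTranslation.

(** * Translations in Banach spaces *)

Section BanachTranslation.
Context {R : realType} {G : groupType} {X : metricType R} {E : normedModType R}.
Variables (al : G -> X -> X) (x : X) (h : G) (F : X -> E) (F' : E -> X).
Hypotheses (act : isometric_action al) (uX : uniquely_geodesic X)
  (FK : cancel F F') (F'K : cancel F' F)
  (F_iso : forall a b, mdist a b = `|F a - F b|).
Hypothesis par : forall g, parallel_seg x (al h x) (al g x) (al g (al h x)).

Let a1 z : al 1%g z = z. Proof. by case: act. Qed.
Let aM g k z : al (g * k)%g z = al g (al k z). Proof. by case: act. Qed.
Let ai g z z' : mdist (al g z) (al g z') = mdist z z'.
Proof. by case: act. Qed.

Let F'_iso a b : mdist (F' a) (F' b) = `|a - b|.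
Proof. by rewrite F_iso !F'K. Qed.

Lemma mid_vec (a b : X) : F (ratio_pt 2^-1 a b) = 2^-1 *: (F a + F b).
Proof.
have half (u : E) : u = 2^-1 *: u + 2^-1 *: u.
  by rewrite -scalerDl (_ : 2^-1 + 2^-1 = 1 :> R) ?scale1r//; lra.
rewrite -[RHS]F'K; congr F; apply/esym/mid_unique => //.
  rewrite -{1}(FK a) F'_iso F_iso [X in X - _]half scalerDr opprD addrACA.
  by rewrite subrr add0r -scalerBr normrZ ger0_norm ?invr_ge0// mulrC.
rewrite -{2}(FK b) F'_iso F_iso [X in _ - X]half scalerDr opprD addrACA.
by rewrite subrr addr0 -scalerBr normrZ ger0_norm ?invr_ge0// mulrC.
Qed.

(** Both [0] and [(u - w) / 2] are midpoints of [u] and [- w], and midpoints are unique. *)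
Lemma strictly_convex_eq (u w : E) :
  `|u| = `|w| -> `|u| = `|2^-1 *: (u + w)| -> u = w.
Proof.
move=> uw um; have d : mdist (F' u) (F' (- w)) = 2 * `|u|.
  by rewrite F'_iso opprK um normrZ ger0_norm ?invr_ge0// mulVKf.
have : F' 0 = ratio_pt 2^-1 (F' u) (F' (- w)).
  apply: mid_unique => //; rewrite d F'_iso ?subr0 ?sub0r ?opprK ?uw; lra.
move=> /(congr1 F); rewrite mid_vec !F'K => /esym/eqP.
by rewrite scaler_eq0 invr_eq0 pnatr_eq0 /= subr_eq0 => /eqP.
Qed.

Lemma parallel_vec (a b a' b' : X) :
  parallel_seg a b a' b' -> F b - F a = F b' - F a'.
Proof.
move=> [h1 h2]; move: h1 h2; rewrite !F_iso !mid_vec => h1 h2.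
have e : F a - F a' = F b - F b'.
  apply: strictly_convex_eq => //; rewrite h1 h2 -scalerBr; congr `|_ *: _|.
  by rewrite opprD addrACA.
by rewrite -[F a](subrK (F a')) e opprD opprB addrA [F b + _]addrC subrK.
Qed.

Definition affine_part g (z : E) : E := F (al g (F' z)).
Local Notation A := affine_part.
Definition linear_part g (z : E) : E := A g z - A g 0.
Local Notation pi := linear_part.

(** Isometries preserve the unique midpoints, which are the vector midpoints; additivity of the
    linear part follows from this. *)
Lemma affine_part_mid g a b : A g (2^-1 *: (a + b)) = 2^-1 *: (A g a + A g b).
Proof.
rewrite /A -mid_vec (mid_isometry _ _ uX (ai g)); congr (F (al g _)).
by rewrite -[RHS]FK mid_vec !F'K.
Qed.

Lemma linear_partD g : {morph pi g : a b / a + b}.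
Proof.
move=> a b; have h2 : 2^-1 != 0 :> R by rewrite invr_eq0 pnatr_eq0.
have := affine_part_mid g (a + b) 0; rewrite addr0 affine_part_mid.
move/(scalerI h2) => e.
by rewrite /pi addrACA e addrA addrK.
Qed.

Lemma linear_part_sub g a b : pi g (a - b) = A g a - A g b.
Proof.
have := linear_partD g (a - b) b; rewrite subrK => e.
by rewrite -[LHS](addrK (pi g b)) -e /pi opprB addrA subrK.
Qed.

Lemma linear_partM g k z : pi (g * k)%g z = pi g (pi k z).
Proof. by rewrite [pi k z]/pi linear_part_sub /pi /A !aM !FK. Qed.

Lemma linear_part1 z : pi 1%g z = z.
Proof. by rewrite /pi /A !a1 !F'K subr0. Qed.

Lemma linear_part_norm g z : `|pi g z| = `|z|.
Proof. by rewrite /pi /A -F_iso ai F'_iso subr0. Qed.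

(** Parallel segments have equal difference vectors, so [v] is fixed by all linear parts. An
    invariant functional norming [v] turns displacements of [x] into a morphism that is bounded on
    [M] and [L] and equals [|v|] at [h]. *)
Lemma banach_parallel_translation_trivial (d : R) (M L S : set G) (y : X) :
  0 < d -> 0 <= 1 - d / 8 -> @uniformly_convex_with R E d ->
  finite_set S -> subgroup_closure S = [set: G] ->
  is_subgroup M -> is_subgroup L ->
  subgroup_closure (M `|` L) = [set: G] ->
  fixed_points al M x -> fixed_points al L y -> al h x = x.
Proof.
move=> d0 d8 uc /finite_seqP[s ->] Sgen sM sL gen Mx Ly.
pose v := F (al h x) - F x.
have AF g z : A g (F z) = F (al g z) by rewrite /A FK.
have piv g : pi g v = v by rewrite linear_part_sub !AF -(parallel_vec (par g)).
(* The neutral element is added so that the random walk has a non-empty step set. *)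
pose I : finType := 'I_(size (1%g :: s)).
pose si (i : I) := nth 1%g (1%g :: s) i.
have I0 : (0 < #|I|)%N by rewrite card_ord.
have [f [fD fle fv finv]] := invariant_functional_ex linear_partD linear_partM
  linear_part1 linear_part_norm I0 d0 d8 uc (fun i => piv (si i)).
have fpi g z : f (pi g z) = f z.
  suff: [set: G] `<=` [set k | forall z, f (pi k z) = f z] by exact.
  rewrite -Sgen; apply: subgroup_closure_ind => [{}g /= gs {}z|{}z||].
  - have ltgs : (index g s < size s)%N by rewrite index_mem.
    have := finv (@Ordinal (size (1%g :: s)) (index g s).+1 ltgs) z.
    by rewrite /si /= nth_index.
  - by rewrite linear_part1.
  - by move=> {}g k hg hk {}z; rewrite linear_partM hg hk.
  - by move=> {}g hg {}z; rewrite -(hg (pi _ z)) -linear_partM mulgV linear_part1.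
pose psi g := f (F (al g x) - F x).
have psiM g k : psi (g * k)%g = psi g + psi k.
  rewrite /psi aM -(fpi g (F (al k x) - F x)).
  by rewrite linear_part_sub !AF -fD [in RHS]addrC addrA subrK.
have psile g : `|psi g| <= mdist x (al g x).
  by rewrite metric_sym F_iso fle.
have := bounded_morphism_eq0 sM sL gen (C := 2 * mdist x y) psiM.
move=> /(_ _ _ h) psi0; have {psi0} : psi h = 0.
  apply: psi0 => g Hg; apply: le_trans (psile g) _.
    by rewrite (Mx _ Hg) mdistxx mulr_ge0 ?mdist_ge0.
  have := metric_triangle x y (al g x).
  by rewrite -{2}(Ly _ Hg) ai (metric_sym y x); lra.
rewrite /psi fv => /normr0_eq0/subr0_eq.
exact: (can_inj FK).
Qed.

End BanachTranslation.

(** * Uniform convexity from ultrapowers *)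

Section UltraproductLimits.
Context {R : realType} (U : set_system nat) (UF : UltraFilter U).

Lemma ultraproduct_cvg (X : nat -> metricType R) (w : forall n, X n)
    (x y : bounded_seq w) :
  (fun n => mdist (sval x n) (sval y n)) @ U -->
  mdist (ultraproduct_pt UF x) (ultraproduct_pt UF y).
Proof. by rewrite ultraproduct_mdist; exact: ultra_dist_cvg. Qed.

Lemma ultraproduct_mdistE (X : nat -> metricType R) (w : forall n, X n)
    (x y : bounded_seq w) (l : R) :
  (fun n => mdist (sval x n) (sval y n)) @ U --> l ->
  mdist (ultraproduct_pt UF x) (ultraproduct_pt UF y) = l.
Proof. exact: (ultra_cvg_unique UF (@ultraproduct_cvg _ _ x y)). Qed.

Lemma ultraproduct_mdist_cst (X : nat -> metricType R) (w : forall n, X n)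
    (x y : bounded_seq w) (l : R) :
  (forall n, mdist (sval x n) (sval y n) = l) ->
  mdist (ultraproduct_pt UF x) (ultraproduct_pt UF y) = l.
Proof.
have PU : ProperFilter U := @ultra_proper _ _ UF.
move=> h; apply: ultraproduct_mdistE.
by under eq_fun do rewrite h; exact: cvg_cst.
Qed.

Lemma ultraproduct_ptP (X : nat -> metricType R) (w : forall n, X n)
  (z : ultraproduct UF w) : exists x, z = ultraproduct_pt UF x.
Proof.
exists (repr (z : {eq_quot ultra_equiv UF w})).
by rewrite /ultraproduct_pt reprK.
Qed.

End UltraproductLimits.

(** Equality holds throughout [2 <= s^2 <= (a + b)^2 <= 2 (a^2 + b^2) = 2]. *)
Lemma extremal_parallelogram {R : realType} (a b s : R) :
  0 <= a -> 0 <= b -> 0 <= s -> a ^+ 2 + b ^+ 2 = 1 -> 2 <= s ^+ 2 ->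
  s <= a + b -> [/\ a = s / 2, b = s / 2 & 0 < (a + b) / 10].
Proof.
move=> a0 b0 s0 ab1 s2 sab.
have s_le : s ^+ 2 <= (a + b) ^+ 2 by rewrite lerXn2r// nnegrE addr_ge0.
have abE : a = b.
  apply/eqP; rewrite -subr_eq0 -sqrf_eq0 eq_le sqr_ge0 andbT; lra.
have sE : s = 2 * a.
  rewrite -abE in ab1 sab s_le; apply/eqP; rewrite eq_le; apply/andP.
  split; first lra.
  by rewrite -(@ler_pXn2r _ 2) ?nnegrE ?mulr_ge0//; lra.
split; [lra|lra|].
rewrite -abE divr_gt0// addr_gt0// lt_neqAle a0 andbT;
  by apply/eqP => az; move: s2; rewrite sE -az mulr0 expr0n /= lern0.
Qed.

Section UltrapowerConvexity.
Context {R : realType} {X : metricType R} {E : normedModType R}.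
Variables (F : X -> E) (F' : E -> X).
Hypotheses (FK : cancel F F') (F'K : cancel F' F)
  (F_iso : forall a b, mdist a b = `|F a - F b|).
Context (U : set_system nat) (UF : UltraFilter U).
Hypotheses (ooU : \oo `<=` U)
  (uX : uniquely_geodesic (ultraproduct UF (fun=> F' 0))).

Let F'_iso a b : mdist (F' a) (F' b) = `|a - b|.
Proof. by rewrite F_iso !F'K. Qed.

(** Otherwise take pairs violating the modulus [1 / (n + 1)], normalised to [|a|^2 + |b|^2 = 1]. In
    the ultrapower both [0] and [(a - b) / 2] become midpoints of [a] and [- b], while the
    separation condition keeps them apart. *)
Lemma ultrapower_uniformly_convex :
  exists d, [/\ 0 < d, 0 <= 1 - d / 8 & @uniformly_convex_with R E d].
Proof.
have e12 : 2^-1 + 2^-1 = 1 :> R by lra.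
have e11 : 1 + 1 <= 2 * 2 :> R by lra.
apply: contrapT => nuc.
have PU : ProperFilter U := @ultra_proper _ _ UF.
have [p pP] : exists p : nat -> E * E, forall n,
  [/\ `|(p n).1| ^+ 2 + `|(p n).2| ^+ 2 = 1,
      (`|(p n).1| + `|(p n).2|) / 10 <= `|(p n).1 - (p n).2| &
      2 * (1 - n.+1%:R^-1) <= `|(p n).1 + (p n).2| ^+ 2].
  suff /choice[p pP] : forall n, exists q : E * E,
    [/\ `|q.1| ^+ 2 + `|q.2| ^+ 2 = 1,
      (`|q.1| + `|q.2|) / 10 <= `|q.1 - q.2| &
      2 * (1 - n.+1%:R^-1) <= `|q.1 + q.2| ^+ 2] by exists p.
  move=> n.
  have n0 : 0 < n.+1%:R^-1 :> R by rewrite invr_gt0 ltr0n.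
  have n1 : n.+1%:R^-1 <= 1 :> R by rewrite invf_le1 ?ltr0n// ler1n.
  have : ~ @uniformly_convex_with R E n.+1%:R^-1.
    by move=> uc; apply: nuc; exists n.+1%:R^-1; split=> //;
      move: n0 n1; move: (n.+1%:R^-1) => e; lra.
  move=> /existsNP[a /existsNP[b /not_implyP[ab /negP]]]; rewrite -ltNge => lt.
  pose q : R := `|a| ^+ 2 + `|b| ^+ 2.
  have q0 : 0 < q.
    rewrite lt_neqAle addr_ge0 ?sqr_ge0// andbT; apply/eqP => q0.
    have := q0; rewrite /q => /esym/eqP; rewrite paddr_eq0 ?sqr_ge0//.
    rewrite !expf_eq0 /= !normr_eq0 => /andP[/eqP az /eqP bz].
    by move: lt; rewrite az bz !normr0 addr0 normr0 !expr0n /= addr0 mulr0 ltxx.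
  pose t := Num.sqrt q; have t0 : 0 < t by rewrite sqrtr_gt0.
  have tt : t ^+ 2 = q by rewrite sqr_sqrtr// ltW.
  have nt (z : E) : `|t^-1 *: z| = t^-1 * `|z|.
    by rewrite normrZ gtr0_norm ?invr_gt0.
  exists (t^-1 *: a, t^-1 *: b); split => /=.
  - by rewrite !nt !exprMn -mulrDr -/q -tt -exprMn mulVf ?expr1n// gt_eqF.
  - by rewrite -scalerBr !nt -mulrDr -mulrA ler_pM2l// invr_gt0.
  - rewrite -scalerDr nt exprMn exprVn tt [leRHS]mulrC ler_pdivlMr//.
    exact: ltW.
have p1 n : `|(p n).1| <= 1 /\ `|(p n).2| <= 1.
  have [h _ _] := pP n; have h1 := sqr_ge0 `|(p n).1|; have h2 := sqr_ge0 `|(p n).2|.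
  by split; rewrite -(@ler_pXn2r _ 2) ?nnegrE// expr1n; lra.
have bd (u : nat -> E) : (forall n, `|u n| <= 2) ->
    exists C : R, forall n, mdist (F' (u n)) (F' 0) <= C.
  by move=> u2; exists 2 => n; rewrite F'_iso subr0.
have ha n : `|(p n).1| <= 2 by have := (p1 n).1; lra.
have hb n : `|- (p n).2| <= 2 by rewrite normrN; have := (p1 n).2; lra.
have ho (n : nat) : `|0 : E| <= 2 by rewrite normr0.
have hm n : `|2^-1 *: ((p n).1 - (p n).2)| <= 2.
  rewrite normrZ ger0_norm ?invr_ge0//.
  have [h1 h2] := p1 n; have h3 := ler_normB (p n).1 (p n).2.
  rewrite -[leRHS](mulKf (_ : (2 : R) != 0))// ler_wpM2l ?invr_ge0//.
  by apply: le_trans h3 _; apply: le_trans (lerD h1 h2) e11.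
pose sq u (hu : forall n, `|u n| <= 2) : bounded_seq (fun=> F' 0) :=
  exist _ (fun n => F' (u n)) (bd u hu).
pose pt u (hu : forall n, `|u n| <= 2) : ultraproduct UF (fun=> F' 0) :=
  ultraproduct_pt UF (sq u hu).
have ptc u v hu hv : (fun n => `|u n - v n|) @ U --> mdist (pt u hu) (pt v hv).
  have := @ultraproduct_cvg R U UF _ _ (sq u hu) (sq v hv).
  by under [X in X @ _]eq_fun => n do rewrite /= F'_iso.
pose a := pt _ ha; pose b := pt _ hb; pose o := pt (fun=> 0) ho; pose m := pt _ hm.
pose al := mdist a o; pose be := mdist o b; pose si := mdist a b.
have alc : (fun n => `|(p n).1|) @ U --> al.
  by have := ptc _ (fun=> 0) ha ho; under [X in X @ _]eq_fun => n do rewrite subr0.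
have bec : (fun n => `|(p n).2|) @ U --> be.
  by have := ptc (fun=> 0) _ ho hb;
    under [X in X @ _]eq_fun => n do rewrite sub0r opprK.
have sic : (fun n => `|(p n).1 + (p n).2|) @ U --> si.
  by have := ptc _ _ ha hb; under [X in X @ _]eq_fun => n do rewrite opprK.
have ab1 : al ^+ 2 + be ^+ 2 = 1.
  apply: (ultra_cvg_unique UF (u := fun n => `|(p n).1| ^+ 2 + `|(p n).2| ^+ 2)).
    by apply: cvgD; [exact: (cvgM alc alc)|exact: (cvgM bec bec)].
  rewrite (_ : (fun n => _) = cst 1); first exact: cvg_cst.
  by apply/funext => n; have [] := pP n.
have si2 : 2 <= si ^+ 2.
  have c0 : (fun n => 1 - n.+1%:R^-1 : R) @ U --> (1 - 0 : R).
    apply: cvgB; first exact: cvg_cst.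
    by apply: (cvg_eventually_ultra ooU); exact: cvg_harmonic.
  have c1 : (fun n => 2 * (1 - n.+1%:R^-1) : R) @ U --> (2 * (1 - 0) : R).
    exact: cvgMl_tmp c0.
  rewrite subr0 mulr1 in c1.
  apply: (ler_cvg_to c1 (cvgM sic sic)); apply: nearW => n.
  by have [] := pP n.
have tri := metric_triangle a o b; rewrite -/al -/be -/si in tri.
have al0 : 0 <= al := mdist_ge0 _ _; have be0 : 0 <= be := mdist_ge0 _ _.
have si0 : 0 <= si := mdist_ge0 _ _.
have [alE beE ab0] := extremal_parallelogram al0 be0 si0 ab1 si2 tri.
have si_half : (fun n => 2^-1 * `|(p n).1 + (p n).2|) @ U --> si / 2.
  by rewrite mulrC; exact: cvgMl_tmp sic.
have half (u : E) : u = 2^-1 *: u + 2^-1 *: u.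
  by rewrite -scalerDl e12 scale1r.
have am : mdist a m = si / 2.
  apply: (ultra_cvg_unique UF (ptc _ _ ha hm)).
  under [X in X @ _]eq_fun => n.
    rewrite [X in X - _]half scalerBr opprB addrACA subrr addr0.
    rewrite -scalerDr normrZ ger0_norm ?invr_ge0//. over.
  by [].
have mb : mdist m b = si / 2.
  apply: (ultra_cvg_unique UF (ptc _ _ hm hb)).
  under [X in X @ _]eq_fun => n.
    rewrite opprK [X in _ + X]half scalerBr addrA subrK.
    rewrite -scalerDr normrZ ger0_norm ?invr_ge0//. over.
  by [].
have om : o = m.
  rewrite (mid_unique uX am mb); exact: mid_unique.
have : (al + be) / 10 <= 2 * mdist o m.
  have c1 : (fun n => (`|(p n).1| + `|(p n).2|) / 10) @ U --> (al + be) / 10.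
    by apply: cvgMr_tmp; apply: cvgD.
  have c2 := ptc (fun=> 0) _ ho hm.
  have c3 : (fun n => 2 * `|0 - 2^-1 *: ((p n).1 - (p n).2)|) @ U --> 2 * mdist o m.
    exact: cvgMl_tmp c2.
  apply: (ler_cvg_to c1 c3).
  apply: nearW => n; rewrite sub0r normrN normrZ ger0_norm ?invr_ge0// mulVKf//.
  by have [] := pP n.
by rewrite om mdistxx mulr0 leNgt ab0.
Qed.

End UltrapowerConvexity.

(** * Actions on ultraproducts *)

Lemma ultrafilter_pick (U : set_system nat) (UF : UltraFilter U) (T : eqType)
    (S : seq T) (P : nat -> T -> Prop) :
  U [set n | exists2 s, s \in S & P n s] -> exists2 s, s \in S & U [set n | P n s].
Proof.
have PU : ProperFilter U := @ultra_proper _ _ UF.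
elim: S => [|s S IH] h.
  by case: (@filter_not_empty _ U); apply: filterS h => n [].
have [Us|Uns] := in_ultra_setVsetC [set n | P n s] UF.
  by exists s; rewrite ?mem_head.
have [|t tS Ut] := IH; last by exists t; rewrite // inE tS orbT.
apply: filterS (filterI h Uns) => n [[t]]; rewrite inE => /predU1P[->//|tS Pt] _.
by exists t.
Qed.

Section UltraproductAction.
Context {R : realType} {G : groupType} (U : set_system nat) (UF : UltraFilter U).
Context (X : nat -> metricType R) (w : forall n, X n)
  (al : forall n, G -> X n -> X n).
Arguments al : clear implicits.
Hypothesis act : forall n, isometric_action (al n).
Hypothesis displ : forall g, exists C : R, forall n, mdist (al n g (w n)) (w n) <= C.

Lemma action_seq_bounded g (x : bounded_seq w) :
  exists C : R, forall n, mdist (al n g (sval x n)) (w n) <= C.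
Proof.
have [C Cw] := displ g; have [D Dx] := svalP x; exists (D + C) => n.
apply: le_trans (metric_triangle _ (al n g (w n)) _) _.
by case: (act n) => _ _ ->; rewrite lerD.
Qed.

Definition action_seq g (x : bounded_seq w) : bounded_seq w :=
  exist _ (fun n => al n g (sval x n)) (action_seq_bounded g x).

(** Defined on the chosen representative; [ultra_actionE] shows that any other gives the same
    point. *)
Definition ultra_action (g : G) (z : ultraproduct UF w) : ultraproduct UF w :=
  ultraproduct_pt UF (action_seq g (repr (z : {eq_quot ultra_equiv UF w}))).

Lemma ultra_actionE g x :
  ultra_action g (ultraproduct_pt UF x) = ultraproduct_pt UF (action_seq g x).
Proof.
rewrite /ultra_action; set x' := repr _.
have e : ultraproduct_pt UF x' = ultraproduct_pt UF x.
  by rewrite /x' /ultraproduct_pt reprK.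
apply: mdist_positivity; rewrite -(mdistxx (ultraproduct_pt UF x)) -{1}e.
apply: ultraproduct_mdistE; have := @ultraproduct_cvg _ _ UF _ _ x' x.
by under [X in _ -> X @ _ --> _]eq_fun => n do [case: (act n) => _ _ /= ->].
Qed.

Lemma ultra_action_dist g x :
  (fun n => mdist (sval x n) (al n g (sval x n))) @ U -->
  mdist (ultraproduct_pt UF x) (ultra_action g (ultraproduct_pt UF x)).
Proof.
rewrite ultra_actionE; exact: (@ultraproduct_cvg _ _ UF _ _ x (action_seq g x)).
Qed.

Lemma ultra_action_isometric : isometric_action ultra_action.
Proof.
split=> [z|g h z|g z z'].
- have [x ->] := ultraproduct_ptP z; rewrite ultra_actionE.
  apply/mdist_positivity/ultraproduct_mdist_cst => n /=.
  by case: (act n) => -> _ _; exact: mdistxx.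
- have [x ->] := ultraproduct_ptP z; rewrite !ultra_actionE.
  apply/mdist_positivity/ultraproduct_mdist_cst => n /=.
  by case: (act n) => _ -> _; exact: mdistxx.
- have [x ->] := ultraproduct_ptP z; have [x' ->] := ultraproduct_ptP z'.
  rewrite !ultra_actionE; apply: ultraproduct_mdistE.
  rewrite (_ : (fun n => _) = fun n => mdist (sval x n) (sval x' n)).
    exact: ultraproduct_cvg.
  by apply/funext => n /=; case: (act n) => _ _ ->.
Qed.

Lemma ultra_action_fixed (K : set G) (x : bounded_seq w) :
  (forall n, fixed_points (al n) K (sval x n)) ->
  fixed_points ultra_action K (ultraproduct_pt UF x).
Proof.
move=> xK g Kg; apply/mdist_positivity; rewrite ultra_actionE.
by apply: ultraproduct_mdist_cst => n /=; rewrite xK// mdistxx.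
Qed.

(** Absence of almost fixed points at scale [c]; since [S] is a finite list, the condition passes to
    ultraproducts. *)
Definition spread {Y : metricType R} (S : seq G) (be : G -> Y -> Y) (c : R) : Prop :=
  forall y, exists2 s, s \in S & c <= mdist y (be s y).

Lemma ultra_action_spread (S : seq G) (c : R) :
  (forall x : bounded_seq w, U [set n | exists2 s, s \in S &
     c <= mdist (sval x n) (al n s (sval x n))]) ->
  spread S ultra_action c.
Proof.
have PU : ProperFilter U := @ultra_proper _ _ UF.
move=> h z; have [x ->] := ultraproduct_ptP z.
have [s sS Us] := ultrafilter_pick UF (h x); exists s => //.
have lc := @ultra_action_dist s x.
have cc : (fun=> c) @ U --> c by exact: cvg_cst.
exact: (ler_cvg_to cc lc).
Qed.

End UltraproductAction.

(** The elements displacing the base points boundedly form a subgroup, so generators suffice. *)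
Lemma displacement_bounded {R : realType} {G : groupType}
    (X : nat -> metricType R) (w : forall n, X n)
    (al : forall n, G -> X n -> X n) (A : set G) :
  (forall n, isometric_action (al n)) -> subgroup_closure A = [set: G] ->
  (forall g, A g -> exists C : R, forall n, mdist (al n g (w n)) (w n) <= C) ->
  forall g, exists C : R, forall n, mdist (al n g (w n)) (w n) <= C.
Proof.
move=> act Agen AC g.
suff : [set: G] `<=`
    [set g | exists C : R, forall n, mdist (al n g (w n)) (w n) <= C].
  by apply.
rewrite -Agen; apply: subgroup_closure_ind => // {g}.
- by exists 0 => n; case: (act n) => -> _ _; rewrite mdistxx.
- move=> g h [C gC] [D hD]; exists (C + D) => n; case: (act n) => _ aM ai.
  rewrite aM; apply: le_trans (metric_triangle _ (al n g (w n)) _) _.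
  by rewrite ai addrC lerD.
- move=> g [C gC]; exists C => n; case: (act n) => a1 aM ai.
  by rewrite -(ai g) -aM mulgV a1 metric_sym.
Qed.

(** * Actions without almost fixed points *)

Section Rescale.
Context {R : realType} {G : groupType} {X : metricType R} (al : G -> X -> X).
Variables (r : R) (r_ge1 : 1 <= r).

Lemma rescaled_isometric_action :
  isometric_action al -> isometric_action (al : G -> rescaled X r_ge1 -> _).
Proof. by case=> a1 aM ai; split=> // g x y; rewrite !rescaledE ai. Qed.

Lemma rescaled_spread (S : seq G) (c c' : R) : c' <= r * c ->
  spread S al c -> spread S (al : G -> rescaled X r_ge1 -> _) c'.
Proof.
move=> cr sp y; have [s sS cs] := sp y; exists s => //.
rewrite rescaledE; apply: le_trans cr _; rewrite ler_wpM2l//.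
exact: le_trans ler01 r_ge1.
Qed.

End Rescale.

Section AlmostFixedPoints.
Context {R : realType} {G : groupType} {X : metricType R} (al : G -> X -> X).
Hypotheses (act : isometric_action al) (cX : complete_space X).
Variable S : seq G.

Definition disp (x : X) : R := \big[Num.max/0]_(s <- S) mdist x (al s x).

Lemma disp_ge0 x : 0 <= disp x.
Proof. exact: bigmax_ge_id. Qed.

Lemma disp_ge x s : s \in S -> mdist x (al s x) <= disp x.
Proof.
by move=> sS; exact: (@le_bigmax_seq _ _ _ S 0 s xpredT (fun s => mdist x (al s x))).
Qed.

Lemma disp_lt x c : 0 < c ->
  (forall s, s \in S -> mdist x (al s x) < c) -> disp x < c.
Proof. by move=> c0 h; rewrite /disp big_seq; apply: bigmax_lt. Qed.

(* Otherwise one can halve the displacement again and again, moving a distance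
   controlled by the displacement, and the limit point is fixed. *)
Lemma almost_minimal_displacement (C : R) (x0 : X) : 0 <= C ->
  (forall x, 0 < disp x) -> disp x0 < 1 ->
  exists2 x, disp x < 1 & forall y, mdist x y <= C * disp x ->
    exists2 s, s \in S & disp x / 2 <= mdist y (al s y).
Proof.
move=> C0 nofix x01; apply: contrapT => no.
have step (x : {x | disp x < 1}) : exists y : {y | disp y < 1},
    mdist (sval x) (sval y) <= C * disp (sval x) /\
    disp (sval y) <= disp (sval x) / 2.
  apply: contrapT => nstep; apply: no; exists (sval x); first exact: (svalP x).
  move=> y xy; apply: contrapT => ns; apply: nstep.
  have dy : disp y < disp (sval x) / 2.
    apply: disp_lt => [|s sS]; first by rewrite divr_gt0.
    by rewrite ltNge; apply/negP => h; apply: ns; exists s.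
  have dy1 : disp y < 1.
    by have := svalP x; have := nofix (sval x); lra.
  by exists (exist _ y dy1); split=> //; exact: ltW.
have [f fP] := choice step.
pose u n := iter n f (exist _ x0 x01).
pose v n := sval (u n).
have dv n : disp (v n) <= 2^-1 ^+ n.
  elim: n => [|n IH]; first exact: ltW.
  have [_ h] := fP (u n); apply: le_trans h _.
  by rewrite exprSr ler_wpM2r// invr_ge0.
(* Partial sums of the geometric series of jumps, written so that the induction telescopes. *)
have vv n k : mdist (v n) (v (n + k)%N) <= 2 * C * (2^-1 ^+ n - 2^-1 ^+ (n + k)).
  elim: k => [|k IH]; first by rewrite addn0 mdistxx subrr mulr0.
  rewrite addnS; apply: le_trans (metric_triangle _ (v (n + k)%N) _) _.
  have [h _] := fP (u (n + k)%N); rewrite -[f _]/(u (n + k).+1) -!/(v _) in h.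
  have := ler_wpM2l C0 (dv (n + k)%N).
  by rewrite exprS; move: IH h; lra.
have h0 (e : R) : 0 < e -> \forall n \near \oo, 2^-1 ^+ n < e.
  move=> e0; have : (2^-1 : R) ^+ n @[n --> \oo] --> 0.
    by apply: cvg_expr; rewrite ger0_norm ?invr_ge0//; lra.
  by move/(cvgr_lt 0); apply.
have vC n k : (n <= k)%N -> mdist (v n) (v k) <= 2 * C * 2^-1 ^+ n.
  move=> /subnKC <-; apply: le_trans (vv _ _) _.
  by rewrite ler_wpM2l ?mulr_ge0// gerBl exprn_ge0// invr_ge0.
have [|x vx] := @cX (v @ \oo) _.
- apply/cauchy_exP => e e0.
  have [|N _ NP] := h0 (e / (2 * C + 1)); first by rewrite divr_gt0//; lra.
  exists (v N), N => // k /= Nk; rewrite ballEmdist /=.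
  apply: le_lt_trans (vC _ _ Nk) _.
  have := NP N (leqnn N); rewrite /= ltr_pdivlMr; last by lra.
  have p0 : 0 <= 2^-1 ^+ N :> R by rewrite exprn_ge0// invr_ge0.
  by lra.
have : disp x <= 0.
  rewrite leNgt; apply/negP => d0.
  have d4 : 0 < disp x / 4 by rewrite divr_gt0.
  have [N1 _ N1P] := h0 _ d4.
  have : (v @ \oo) (ball x (disp x / 4)) by apply: vx; exact: nbhsx_ballx.
  move=> [N2 _ N2P]; pose k := maxn N1 N2.
  have vk := N1P k (leq_maxl _ _); have xk := N2P k (leq_maxr _ _).
  move: xk; rewrite /= ballEmdist /= => xk; have dk := dv k.
  have : disp x < disp x; last by rewrite ltxx.
  apply: disp_lt => // s sS; have sk := disp_ge (v k) sS.
  have t1 := metric_triangle x (v k) (al s x).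
  have t2 := metric_triangle (v k) (al s (v k)) (al s x).
  have ai : mdist (al s (v k)) (al s x) = mdist x (v k).
    by case: act => _ _ ->; rewrite metric_sym.
  by move: vk => /= vk; lra.
by rewrite leNgt nofix.
Qed.

End AlmostFixedPoints.

Section SpreadAction.
Context {R : realType} (XX : metricType R -> Prop) {G : groupType}.
Hypotheses (XX_complete : forall X, XX X -> complete_space X)
  (XX_S : S_plus XX).
Context (U : set_system nat) (UF : UltraFilter U).
Hypotheses (ooU : \oo `<=` U)
  (XX_U : forall (X : nat -> metricType R) (w : forall n, X n),
      (forall n, XX (X n)) -> XX (ultraproduct UF w)).
Variable S : seq G.
Hypothesis S_gen : subgroup_closure [set` S] = [set: G].

(** If displacements are bounded below, rescaling suffices. Otherwise rescale by the inverse
    displacement around almost minimal points [w n]: generators then move the base points by at most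
    1, and every point within rescaled distance [n] is moved by at least 1/2. *)
Lemma spread_action_ex (X : metricType R) (al : G -> X -> X) :
  XX X -> isometric_action al -> ~ (fixed_points al [set: G] !=set0) ->
  exists (Y : metricType R) (be : G -> Y -> Y),
    [/\ XX Y, isometric_action be & spread S be 1].
Proof.
move=> XX_X act nofix.
have [[c [c0 sp]]|nsp] := pselect (exists c, 0 < c /\ spread S al c).
  (* [S_plus] allows only factors at least 1, hence the maximum here and the condition [disp < 1]
     below. *)
  have r1 : 1 <= Num.max 1 c^-1 by rewrite le_max lexx.
  exists (rescaled X r1), al; split; first exact: XX_S.
    exact: rescaled_isometric_action.
  apply: rescaled_spread sp.
  by rewrite -(mulVf (lt0r_neq0 c0)) ler_wpM2r ?(ltW c0)// le_max lexx orbT.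
have [a1 aM ai] := act.
have d0 x : 0 < disp al S x.
  rewrite lt_neqAle disp_ge0 andbT; apply/eqP => dx; apply: nofix; exists x => g _.
  suff : [set: G] `<=` [set g | al g x = x] by apply.
  rewrite -S_gen; apply: subgroup_closure_ind => //= [s sS|g' h gx hx|g' gx].
  - apply/esym/mdist_positivity/eqP; rewrite eq_le mdist_ge0 andbT.
    by have := disp_ge al x sS; rewrite -dx.
  - by rewrite aM hx.
  - by rewrite -{1}gx -aM mulVg a1.
have [x0 x01] : exists x0, disp al S x0 < 1.
  apply: contrapT => no; apply: nsp; exists 1; split=> // y.
  apply: contrapT => ns; apply: no; exists y; apply: disp_lt => // s sS.
  by rewrite ltNge; apply/negP => h; apply: ns; exists s.
have cX := XX_complete XX_X.
have /choice[w wP] (n : nat) : exists x, disp al S x < 1 /\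
   forall y, mdist x y <= n%:R * disp al S x ->
    exists2 s, s \in S & disp al S x / 2 <= mdist y (al s y).
  have [x x1 xP] := almost_minimal_displacement act cX (ler0n R n) d0 x01.
  by exists x.
have r1 n : 1 <= (disp al S (w n))^-1.
  by rewrite invf_ge1// ltW//; case: (wP n).
pose Xn n : metricType R := rescaled X (r1 n).
pose wn n : Xn n := w n.
pose aln n : G -> Xn n -> Xn n := al.
have actn n : isometric_action (aln n) by exact: rescaled_isometric_action.
have displ : forall g, exists C : R, forall n, mdist (aln n g (wn n)) (wn n) <= C.
  apply: (displacement_bounded actn S_gen) => s /= sS; exists 1 => n.
  rewrite rescaledE ler_pdivrMl// mulr1 metric_sym; exact: disp_ge.
pose Y : metricType R := ultraproduct UF wn.
pose be : G -> Y -> Y := ultra_action actn displ.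
have XX_Y : XX Y by apply: XX_U => n; exact: XX_S.
have act_be : isometric_action be := ultra_action_isometric UF actn displ.
have sp : spread S be 2^-1.
  apply: ultra_action_spread => x; apply: ooU; have [C Cx] := svalP x.
  exists (Num.bound `|C|) => // n /= nC.
  have Cn : C <= n%:R.
    apply: le_trans (ler_norm _) _.
    apply: le_trans (ltW (archi_boundP (normr_ge0 C))) _.
    by rewrite ler_nat.
  have := Cx n; rewrite metric_sym rescaledE ler_pdivrMl// => xn.
  have xn' : mdist (w n) (sval x n : X) <= n%:R * disp al S (w n).
    by apply: le_trans xn _; rewrite mulrC ler_wpM2r// ltW.
  have [s sS ds] := (wP n).2 _ xn'.
  exists s => //; rewrite rescaledE ler_pdivlMl//.
have r2 : 1 <= 2 :> R by rewrite ler1n.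
exists (rescaled Y r2), be; split; first exact: XX_S.
  exact: rescaled_isometric_action.
by apply: rescaled_spread sp; rewrite mulfV.
Qed.

End SpreadAction.

(** * Minimal pairs and the game *)

Lemma ord2P (i : 'I_2) : i = ord0 \/ i = ord_max.
Proof.
by case: i => [[|[|i]] lt] //; [left|right]; apply: val_inj.
Qed.

Section MinimalPairs.
Context {R : realType} (XX : metricType R -> Prop) {G : groupType}.
Variables (M L : set G) (S : seq G).

Definition admissible_pair (d : R) (X : metricType R) (al : G -> X -> X)
    (p : 'I_2 -> X) : Prop :=
  [/\ XX X, isometric_action al, spread S al 1,
      forall i, fixed_points al (initial_state M L i) (p i) &
      mdist (p ord0) (p ord_max) = d].

Definition admissible_distances : set R :=
  [set d | exists (X : metricType R) (al : G -> X -> X) p, admissible_pair d al p].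

Local Notation D := (inf admissible_distances).

Lemma admissible_distances_lb : lbound admissible_distances 0.
Proof. by move=> _ [X [al [p [_ _ _ _ <-]]]]; exact: mdist_ge0. Qed.

Lemma inf_admissible_le (X : metricType R) (al : G -> X -> X) d p :
  admissible_pair d al p -> D <= d.
Proof.
move=> h; apply: ge_inf; last by exists X, al, p.
by exists 0; exact: admissible_distances_lb.
Qed.

Context (U : set_system nat) (UF : UltraFilter U).
Hypotheses (ooU : \oo `<=` U)
  (XX_U : forall (X : nat -> metricType R) (w : forall n, X n),
      (forall n, XX (X n)) -> XX (ultraproduct UF w)).
Hypothesis ML_gen : subgroup_closure (M `|` L) = [set: G].

(** Ultraproduct of a minimising sequence, based at the points fixed by [M]; these are moved
    boundedly by [L] because fixed points of [L] lie at bounded distance. *)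
Lemma inf_admissible_attained :
  admissible_distances !=set0 -> admissible_distances D.
Proof.
move=> DS0; have PU : ProperFilter U := @ultra_proper _ _ UF.
have hinf : has_inf admissible_distances.
  by split=> //; exists 0; exact: admissible_distances_lb.
pose T := {X : metricType R & ((G -> X -> X) * ('I_2 -> X))%type}.
have /choice[t tP] (n : nat) : exists t : T, exists2 d,
    d < D + n.+1%:R^-1 & admissible_pair d (projT2 t).1 (projT2 t).2.
  have n0 : 0 < n.+1%:R^-1 :> R by rewrite invr_gt0 ltr0n.
  have [d [X [al [p adm]]] dD] := inf_adherent n0 hinf.
  by exists (existT _ X (al, p)), d.
pose X n := projT1 (t n); pose al n : G -> X n -> X n := (projT2 (t n)).1.
pose p n : 'I_2 -> X n := (projT2 (t n)).2.
have pD n : mdist (p n ord0) (p n ord_max) <= D + n.+1%:R^-1.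
  by have [d dD [_ _ _ _ e]] := tP n; rewrite [mdist _ _]e ltW.
have pD1 n : mdist (p n ord0) (p n ord_max) <= D + 1.
  by apply: le_trans (pD n) _; rewrite lerD2l invf_le1 ?ltr0n// ler1n.
have act n : isometric_action (al n) by have [d _ []] := tP n.
have fixp n i : fixed_points (al n) (initial_state M L i) (p n i).
  by have [d _ []] := tP n.
pose w n := p n ord0.
have displ : forall g, exists C : R, forall n, mdist (al n g (w n)) (w n) <= C.
  apply: (displacement_bounded act ML_gen) => g [Mg|Lg].
    by exists 0 => n; rewrite (fixp n ord0 g Mg) mdistxx.
  exists (2 * (D + 1)) => n; have [_ _ ai] := act n.
  apply: le_trans (metric_triangle _ (p n ord_max) _) _.
  have -> : mdist (al n g (w n)) (p n ord_max) = mdist (p n ord0) (p n ord_max).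
    by rewrite -{1}(fixp n ord_max g Lg) ai.
  rewrite (metric_sym _ (w n)) -/(w n) /w mulr2n mulrDl mul1r.
  exact: lerD (pD1 n) (pD1 n).
have pb i : exists C : R, forall n, mdist (p n i) (w n) <= C.
  exists (D + 1) => n; have [->|->] := ord2P i.
    by rewrite mdistxx (le_trans (mdist_ge0 _ _) (pD1 n)).
  by rewrite metric_sym.
pose q i : bounded_seq w := exist _ (fun n => p n i) (pb i).
pose P i := ultraproduct_pt UF (q i).
exists (ultraproduct UF w), (ultra_action act displ), P.
have adm : admissible_pair (mdist (P ord0) (P ord_max))
   (ultra_action (UF := UF) act displ) P.
  split=> //.
  - by apply: XX_U => n; have [d _ []] := tP n.
  - exact: ultra_action_isometric.
  - apply: ultra_action_spread => x; apply: filterE => n.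
    by have [d _ [_ _ sp _ _]] := tP n; exact: sp.
  - by move=> i; apply: ultra_action_fixed => n; exact: fixp.
have DE : mdist (P ord0) (P ord_max) = D.
  apply/eqP; rewrite eq_le (inf_admissible_le adm) andbT.
  have c1 := @ultraproduct_cvg _ _ UF _ _ (q ord0) (q ord_max).
  have c2 : (fun n => D + n.+1%:R^-1) @ U --> D + 0.
    apply: cvgD; first exact: cvg_cst.
    by apply: (cvg_eventually_ultra ooU); exact: cvg_harmonic.
  rewrite addr0 in c2; apply: (ler_cvg_to c1 c2).
  by apply: nearW => n; exact: pD.
by rewrite DE in adm.
Qed.

End MinimalPairs.

(** * Twisting actions by automorphisms *)

Section Twist.
Context {R : realType} {G : groupType}.
Variable Pi : set (G -> G).
Hypothesis Pi_sub : is_aut_subgroup Pi.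

Lemma aut_subgroup_bijective psi : Pi psi ->
  exists2 psi', Pi psi' & cancel psi psi' /\ cancel psi' psi.
Proof.
case: Pi_sub => PA _ _ PV Pp; have [[psi' k k'] _] := PA _ Pp.
by exists psi' => //; exact: PV k k'.
Qed.

Lemma inn_mul_morphism phi : inn_mul Pi phi ->
  phi 1%g = 1%g /\ {morph phi : x y / (x * y)%g}.
Proof.
case: Pi_sub => PA _ _ _ [g [psi Pp ->]]; have [_ pM] := PA _ Pp.
have p1 : psi 1%g = 1%g by apply: (mulgI (psi 1%g)); rewrite -pM !mulg1.
split; first by rewrite p1 mulg1 mulgV.
by move=> x y; rewrite pM !mulgA mulgVK.
Qed.

Lemma twist_isometric_action (X : metricType R) (al : G -> X -> X) phi :
  inn_mul Pi phi -> isometric_action al ->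
  isometric_action (fun g => al (phi g)).
Proof.
move=> /inn_mul_morphism[p1 pM] [a1 aM ai].
by split=> [x|g h x|g x y]; rewrite ?p1 ?a1 ?pM ?aM ?ai.
Qed.

(** Under [phi], the element [psi^-1 s] acts as the conjugate of [s] by [g], so it moves [y] as far
    as [s] moves [g^-1 y]. *)
Lemma twist_spread (X : metricType R) (al : G -> X -> X) (S : seq G) c phi :
  (forall psi s, Pi psi -> s \in S -> psi s \in S) ->
  inn_mul Pi phi -> isometric_action al ->
  spread S al c -> spread S (fun g => al (phi g)) c.
Proof.
move=> PS [g [psi Pp ->]] [a1 aM ai] sp y.
have [s sS cs] := sp (al g^-1%g y).
have [psi' Pp' [_ k']] := aut_subgroup_bijective Pp.
exists (psi' s); first exact: PS.
rewrite k' !aM -{1}(a1 y) -(mulgV g) aM ai.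
exact: cs.
Qed.

Lemma invariant_generating_seq : finite_set Pi -> finitely_generated G ->
  exists2 S : seq G, subgroup_closure [set` S] = [set: G] &
    forall psi s, Pi psi -> s \in S -> psi s \in S.
Proof.
case: Pi_sub => _ Pid PM _ fPi [A fA Agen].
have /finite_seqP[S SE] : finite_set (\bigcup_(psi in Pi) (psi @` A)).
  by apply: bigcup_finite => // psi _; exact: finite_image.
have inS x : (x \in S) <-> (\bigcup_(psi in Pi) (psi @` A)) x by rewrite SE.
exists S.
  apply/seteqP; split=> // g _; have : [set: G] g by [].
  rewrite -Agen; apply: sub_smallest2r; last first.
    by move=> a Aa; apply/inS; exists id => //; exists a.
  split; first by rewrite inE => K [/subgroup1].
  move=> x y; rewrite !inE => cx cy K [sK SK].
  have := (sK.2 x y); rewrite !inE; apply; [exact: cx|exact: cy].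
move=> psi s Pp /inS[psi' Pp' [a Aa <-]]; apply/inS.
by exists (psi \o psi'); [exact: PM|exists a].
Qed.

End Twist.

Lemma fixed_points_closure {R : realType} {G : groupType} (X : metricType R)
    (al : G -> X -> X) (A : set G) x : isometric_action al ->
  fixed_points al A x -> fixed_points al (subgroup_closure A) x.
Proof.
move=> [a1 aM _] Ax; apply: (@subgroup_closure_ind _ A [set g | al g x = x]) => //.
- by move=> g h /= gx hx; rewrite aM hx.
- by move=> g /= gx; rewrite -{1}gx -aM mulVg a1.
Qed.

(** * Fixed points of minimal pairs along the game *)

Section Game.
Context {R : realType} (XX : metricType R -> Prop) {G : groupType}.
Hypotheses (XX_NPC1 : forall X, XX X -> NPC1 X)
  (XX_NPC2 : forall X, XX X -> NPC2 X)
  (XX_NPC3 : forall X, XX X -> NPC3 X)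
  (XX_TP : forall X, XX X -> TP X)
  (XX_type : (forall X, XX X -> is_banach X) \/ (forall X, XX X -> is_CAT0 X)).
Variables (M L : set G) (S : seq G) (Pi : set (G -> G)).
Hypotheses (M_sub : is_subgroup M) (L_sub : is_subgroup L)
  (ML_gen : subgroup_closure (M `|` L) = [set: G])
  (S_gen : subgroup_closure [set` S] = [set: G])
  (S_inv : forall psi s, Pi psi -> s \in S -> psi s \in S)
  (Pi_sub : is_aut_subgroup Pi).
Context (U : set_system nat) (UF : UltraFilter U).
Hypotheses (ooU : \oo `<=` U)
  (XX_U : forall (X : nat -> metricType R) (w : forall n, X n),
      (forall n, XX (X n)) -> XX (ultraproduct UF w)).

Lemma parallel_translation_trivial (X : metricType R) (al : G -> X -> X)
    (x y : X) (h : G) :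
  XX X -> isometric_action al ->
  (forall g, parallel_seg x (al h x) (al g x) (al g (al h x))) ->
  fixed_points al M x -> fixed_points al L y -> al h x = x.
Proof.
move=> XX_X act par Mx Ly.
have [uX _] := XX_NPC1 XX_X.
case: XX_type => [ban|cat].
  have [E [F [[F' FK F'K] F_iso]]] := ban _ XX_X.
  have [d [d0 d8 uc]] := ultrapower_uniformly_convex F'K F_iso ooU
    (XX_NPC1 (@XX_U (fun=> X) (fun=> F' 0) (fun=> XX_X))).1.
  exact: (banach_parallel_translation_trivial act uX FK F'K F_iso par d0 d8 uc
    (finite_seq S) S_gen M_sub L_sub ML_gen Mx Ly).
exact: (CAT0_parallel_translation_trivial act (XX_NPC1 XX_X) (XX_NPC2 XX_X)
  (XX_NPC3 XX_X) (XX_TP XX_X) par (cat _ XX_X) M_sub L_sub ML_gen Mx Ly).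
Qed.

Local Notation D := (inf (admissible_distances XX M L S)).
Local Notation minimal al p := (admissible_pair XX M L S D al p).

Lemma minimal_pair_fixed (X : metricType R) (al : G -> X -> X) p h :
  minimal al p -> (forall i, fixed_points al (initial_state M L i) (al h (p i))) ->
  forall i, al h (p i) = p i.
Proof.
move=> [XX_X act sp fixp pD] fixhp.
have xymin x' y' : fixed_points al M x' -> fixed_points al L y' ->
    mdist (p ord0) (p ord_max) <= mdist x' y'.
  move=> Mx Ly; rewrite pD.
  apply: (@inf_admissible_le _ _ _ _ _ _ _ al _
    (fun i => if i == ord0 then x' else y')).
  by split=> // i; rewrite /initial_state; case: ifP.
have [e par] := minimal_pair_parallel M_sub ML_gen act (XX_NPC1 XX_X) (XX_NPC2 XX_X)
  (XX_TP XX_X) (fixp ord0) (fixp ord_max) xymin (fixhp ord0) (fixhp ord_max).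
have h0 : al h (p ord0) = p ord0.
  exact: (parallel_translation_trivial XX_X act par (fixp ord0) (fixp ord_max)).
move=> i; have [->|->] := ord2P i => //.
by apply/esym/mdist_positivity; rewrite -e h0 mdistxx.
Qed.

Lemma game_invariant (H : 'I_2 -> set G) : game_reachable M L Pi H ->
  forall (X : metricType R) (al : G -> X -> X) p, minimal al p ->
  forall i, fixed_points al (H i) (p i).
Proof.
elim=> {H} [|H H' _ IH [P [PH H'E]]|s H H' _ IH [Lam [LP LH H'E]]] X al p mp.
- by case: mp.
- have [XX_X act sp fixp pD] := mp; have [a1 aM _] := act.
  move=> i; rewrite H'E; apply: fixed_points_closure => // g [Hg|Pg].
    exact: IH Hg.
  (* An element [g k' g^-1] of [M] or [L] with [k'] in [H j] fixes [g p_j], since [k'] fixes [p_j]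
     by induction. *)
  apply: (minimal_pair_fixed (p := p) mp) => j k /(PH _ Pg j)[k' Hk' <-].
  by rewrite !aM -[al g^-1%g _]aM mulVg a1 (IH _ _ _ mp j).
- have [XX_X act sp fixp pD] := mp.
  move=> j; rewrite H'E; apply: fixed_points_closure => // g.
  move=> [Hg|[phi Lphi [k Hk <-]]].
    exact: IH Hg.
  have innphi := LP _ Lphi.
  (* The twisted action with the pair permuted by [s^-1] is again minimal; the induction hypothesis
     at index [s j] then says that [phi (H (s j))] fixes [p j]. *)
  have mq : minimal (fun k => al (phi k)) (fun i => p ((s^-1)%g i)).
    split=> //.
    + exact: (twist_isometric_action Pi_sub).
    + exact: (twist_spread Pi_sub).
    + move=> i k' ik; apply: (IH _ _ _ mp); apply: (LH _ Lphi i).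
      by exists k'.
    + rewrite -pD; have : (s^-1)%g ord0 != (s^-1)%g ord_max.
        by rewrite (inj_eq perm_inj).
      have [->|->] := ord2P ((s^-1)%g ord0);
      have [->|->] := ord2P ((s^-1)%g ord_max); rewrite ?eqxx// => _.
      exact: metric_sym.
  by have := IH _ _ _ mq (s j) k Hk; rewrite permK.
Qed.

End Game.

Theorem theorem2 (R : realType) (XX : metricType R -> Prop)
    (XX_nonempty : exists X, XX X)
    (XX_spaces : forall X, XX X -> nonempty_space X /\ complete_space X)
    (XX_S : S_plus XX)
    (XX_U : U_closed XX)
    (XX_NPC1 : forall X, XX X -> NPC1 X)
    (XX_NPC2 : forall X, XX X -> NPC2 X)
    (XX_NPC3 : forall X, XX X -> NPC3 X)
    (XX_TP : forall X, XX X -> TP X)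
    (XX_type : (forall X, XX X -> is_banach X) \/
               (forall X, XX X -> is_CAT0 X))
    (G : groupType) (G_fg : finitely_generated G)
    (M L : set G) (M_sub : is_subgroup M) (L_sub : is_subgroup L)
    (Pi : set (G -> G)) (Pi_sub : is_aut_subgroup Pi)
    (ML_gen : subgroup_closure (M `|` L) = [set: G])
    (Pi_fin : finite_set Pi)
    (game : game_winnable M L Pi)
    (FM : relative_F XX M) (FL : relative_F XX L) :
  property_F XX G.
Proof.
have [U [UF [np XU]]] := XX_U; have ooU := nonprincipal_sub_eventually UF np.
have [S S_gen S_inv] := invariant_generating_seq Pi_sub Pi_fin G_fg.
have XX_complete X (XX_X : XX X) := (XX_spaces X XX_X).2.
move=> X XX_X al act; apply: contrapT => nofix.
have [Y [be [XX_Y act_be sp]]] :=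
  spread_action_ex XX_complete XX_S ooU XU S_gen XX_X act nofix.
have [x Mx] := FM Y XX_Y be act_be; have [y Ly] := FL Y XX_Y be act_be.
have [] := @inf_admissible_attained _ XX _ M L S _ UF ooU XU ML_gen.
  exists (mdist x y), Y, be, (fun i => if i == ord0 then x else y).
  by split=> // i; rewrite /initial_state; case: ifP.
move=> Z [ga [p mp]]; have [H reach [i Hi]] := game.
have := game_invariant XX_NPC1 XX_NPC2 XX_NPC3 XX_TP XX_type M_sub L_sub ML_gen
  S_gen S_inv Pi_sub ooU XU reach mp (i := i).
(* A point fixed by all of [G] cannot be moved by at least 1 by some element of [S]. *)
rewrite Hi => fixi; have [_ _ spZ _ _] := mp; have [s _] := spZ (p i).
by rewrite fixi// mdistxx ler10.
Qed.
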